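(* Let $G$ be a countably infinite discrete abelian group. Let $(g_k)_{k\geqslant 0}$ be a sequence of elements of $G$. (1) When the subgroup $G_0$ of $G$ generated by the sequence $(g_k)_{k\geqslant 0}$ is of infinite index in $G$ (that is, if the factor group $G/G_0$ is infinite), then $(g_k)_{k\geqslant 0}$ is not a $G$-Jamison sequence. (2) If the index $[G:G_0]$ is finite, then one can assume without loss of generality that $G=G_0$ and, under this assumption, $(g_k)_{k\geqslant 0}$ is a $G$-Jamison sequence if and only if there exists a positive real number $\varepsilon$ such that for every character $\chi\in\widehat{G}\setminus\{\mathbf{1}\}$, $$\sup_{k\geqslant 0}|\chi(g_k)-1|\geqslant \varepsilon .$$
   Context: For a complex Banach space $X$, $\mathcal{GL}(X)$ denotes the group of invertible bounded linear operators on $X$. A representation of a topological abelian group $G$ is a couple $(X,\rho)$ where $X$ is a separable infinite-dimensional complex Banach space and $\rho:G\to\mathcal{GL}(X)$ is a continuous homomorphism of groups. $\mathbb{T}$ is the unit circle of the complex plane. $\widehat{G}$ is the group of all continuous homomorphisms (characters) $\chi:G\to\mathbb{T}$; for $G$ discrete, these are all the homomorphisms from $G$ to $\mathbb{T}$. $\mathbf{1}$ denotes the trivial character, identically equal to $1$. A character $\chi\in\widehat{G}$ is a unimodular eigenvalue of a representation $(X,\rho)$ of $G$ if there exists $e_\chi\in X\setminus\{0\}$ such that $\rho(g)e_\chi=\chi(g)e_\chi$ for every $g\in G$. The set of unimodular eigenvalues of $\rho$ is called the unimodular point spectrum of $\rho$ and is denoted by $\sigma_p(\rho)\cap\widehat{G}$.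 The representation is partially bounded with respect to a sequence $(g_k)_{k\geqslant 0}$ of elements of $G$ if $\sup_{k\geqslant 0}\|\rho(g_k)\|<+\infty$. A sequence $(g_k)_{k\geqslant 0}$ of elements of $G$ is a $G$-Jamison sequence if for every representation $(X,\rho)$ of $G$ which is partially bounded with respect to $(g_k)_{k\geqslant 0}$, the unimodular point spectrum $\sigma_p(\rho)\cap\widehat{G}$ is at most countable. The index $[G:G_0]$ is the cardinality of the quotient group $G/G_0$. *)

(* Defs.v *)
From HB Require Import structures.
From mathcomp Require Import all_boot all_order all_algebra.
From mathcomp Require Import complex.
From mathcomp Require Import all_classical all_reals all_analysis.

Set Implicit Arguments.
Unset Strict Implicit.
Unset Printing Implicit Defensive.

Import Order.TTheory GRing.Theory Num.Theory.
Import numFieldNormedType.Exports.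

Local Open Scope classical_set_scope.
Local Open Scope ring_scope.

(** Abelian groups are written additively ([zmodType]). They are all discrete,
    so that every homomorphism defined on them is continuous: the continuity
    required of characters and of representations is void. *)

Section Subgroup.
Variable G : zmodType.

Definition subgroup_gen (g : nat -> G) : {pred G} :=
  mem (smallest (fun H : set G => zmod_closed (mem H)) (range g)).

Lemma subgroup_gen_closed (g : nat -> G) : zmod_closed (subgroup_gen g).
Proof.
split=> [|x y]; rewrite /subgroup_gen ?inE.
  by move=> H [[H0 _] _]; move: H0; rewrite inE.
move=> Hx Hy H [HH gH]; have [_ HB] := HH.
by have := HB x y; rewrite !inE; apply; [exact: Hx|exact: Hy].
Qed.

HB.instance Definition _ (g : nat -> G) :=
  GRing.isZmodClosed.Build G (subgroup_gen g) (subgroup_gen_closed g).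

Definition subgroup_type (g : nat -> G) := {x : G | x \in subgroup_gen g}.

HB.instance Definition _ (g : nat -> G) := SubChoice.on (subgroup_type g).
HB.instance Definition _ (g : nat -> G) :=
  [SubChoice_isSubZmodule of subgroup_type g by <:].

Lemma mem_subgroup_gen (g : nat -> G) k : g k \in subgroup_gen g.
Proof. by rewrite /subgroup_gen inE => H [_]; apply; exists k. Qed.

Definition subgroup_seq (g : nat -> G) (k : nat) : subgroup_type g :=
  exist _ (g k) (mem_subgroup_gen g k).

Definition quotient_type (g : nat -> G) : Type :=
  Quotient.quot (subgroup_gen g).

End Subgroup.

Section Jamison.
Variable R : realType.

Local Notation C := R[i].

(* In a normed space over [C] the library norm takes its values in [C], in the
   nonnegative reals; this is the same number, as an extended real. *)
Definition enorm (V : normedModType C) (x : V) : \bar R :=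
  (complex.Re `|x|)%:E.

Definition opnorm (X : normedModType C) (T : X -> X) : \bar R :=
  ereal_sup [set enorm (T x) | x in [set x | `|x| <= 1]].

Definition bounded_operator (X : normedModType C) (T : X -> X) : Prop :=
  linear T /\ (opnorm T < +oo)%E.

Definition GL (X : normedModType C) : set (X -> X) :=
  [set T | bounded_operator T /\
     exists S : X -> X, [/\ bounded_operator S, cancel T S & cancel S T]].

Definition separable (X : topologicalType) : Prop :=
  exists2 D : set X, countable D & dense D.

Definition infinite_dimensional (X : lmodType C) : Prop :=
  forall (n : nat) (e : 'I_n -> X),
    exists x : X, forall a : 'I_n -> C, x <> \sum_(i < n) a i *: e i.

Definition representation (G : zmodType) (X : completeNormedModType C)
    (rho : G -> X -> X) : Prop :=
  [/\ separable X, infinite_dimensional X,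
      forall g, GL (rho g)
    & forall g h, rho (g + h) = rho g \o rho h].

Definition character (G : zmodType) : set (G -> C) :=
  [set chi | (forall g, `|chi g| = 1) /\
             (forall g h, chi (g + h) = chi g * chi h)].

Definition trivial_character (G : zmodType) : G -> C := fun=> 1.

Definition unimodular_point_spectrum (G : zmodType)
    (X : completeNormedModType C) (rho : G -> X -> X) : set (G -> C) :=
  [set chi | character chi /\
     exists2 e : X, e != 0 & forall g, rho g e = chi g *: e].

Definition partially_bounded (G : zmodType) (X : completeNormedModType C)
    (rho : G -> X -> X) (g : nat -> G) : Prop :=
  (ereal_sup (range (fun k => opnorm (rho (g k)))) < +oo)%E.

Definition Jamison_sequence (G : zmodType) (g : nat -> G) : Prop :=
  forall (X : completeNormedModType C) (rho : G -> X -> X),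
    representation rho -> partially_bounded rho g ->
    countable (unimodular_point_spectrum rho).

End Jamison.

Arguments trivial_character R G : clear implicits.

(* Main.v *)
From HB Require Import structures.
Require Import Defs.
From mathcomp Require Import all_boot all_order all_algebra.
From mathcomp Require Import complex ring lra zify.
From mathcomp Require Import all_classical all_reals all_analysis.

Set Implicit Arguments.
Unset Strict Implicit.
Unset Printing Implicit Defensive.

Import Order.TTheory GRing.Theory Num.Theory.
Import numFieldNormedType.Exports.

Local Open Scope classical_set_scope.
Local Open Scope ring_scope.

(** Call the gauge of a character [chi] the number [sup_k |chi (g k) - 1|].
The gap condition says that the gauge of a nontrivial character is bounded
below.

The gap condition suffices.  Let [||rho (g k)|| <= M] for all [k], and let [e],
[f] be unit eigenvectors for distinct characters [chi], [psi].  From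
[(chi (g k) - psi (g k)) f = rho (g k) (e - f) + chi (g k) (f - e)] one gets
[|chi (g k) - psi (g k)| <= (M + 1) ||e - f||], so the gap keeps the
eigenvectors a fixed distance apart, and a separable space has room for
countably many of them only ([separating_spectrum_countable]).

All the counterexamples come from one construction,
[fast_characters_not_Jamison].  It needs nontrivial characters [chi_n] for which
[2^n |chi_n h - 1|] is bounded in [n] for every [h], with a common bound when [h]
runs over the [g k].  Then [l h = sup_n 2^n |chi_n h - 1|] is subadditive and is
bounded on the [g k].  For the norm [sup_h |x h| / (1 + l h)] on functions
[x : G -> C], translation by [h] has norm at most [1 + l h], hence is bounded
uniformly along [g]; every character is an eigenvector of all translations; and
[chi_n] tends to [1].  The closed span of the finite products of a suitable
subsequence of [chi_n] is thus a separable, translation invariant Banach space.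
The characters in it include all the limits of these products, and a diagonal
argument shows that they are uncountably many ([chain_closure_diagonal]).

Such characters exist in each case where they are wanted.

If the [g k] generate [G] and the gap fails, take [chi_n] nontrivial of gauge at
most [2^-n]: the elements [h] where [2^n |chi_n h - 1|] is bounded form a
subgroup, which is [G].

If the subgroup [G0] generated by the [g k] has infinite index, it is enough that
the trivial character is not isolated among the characters of [G / G0], for
pointwise convergence ([annihilator_not_isolated]).  Given finitely many elements
of [G], either they generate together with [G0] a proper subgroup, and some
nontrivial character is trivial on that subgroup ([character_separation]); or
they generate [G / G0].  In the latter case Dirichlet's simultaneous
approximation brings a power, of bounded order, of every character close to [1]
on the generators.  If [1] were isolated, these powers would be trivial, so
[G / G0], being finitely generated, would have finite exponent and be finite.

If [G0] has finite index and [m G] lies in [G0], then [h |-> chi (m h)] turns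
rapidly convergent characters of [G0] into such characters of [G], which carries
the failure of the Jamison property from [G0] to [G].  Conversely, a
representation of [G] bounded along [g] is also bounded on the finitely many
coset representatives, and these detect the characters that are trivial on [G0],
because a complex number [z <> 1] of modulus [1] has a power at distance at least
[1/2] from [1]. *)

(** * Moduli of complex numbers *)

Section Modulus.
Variable R : realType.
Local Notation C := R[i].
Implicit Types z : C.

(** The norm of [R[i]] takes its values in [R[i]], where the order is partial;
this is the same number in [R], where linear arithmetic is available. *)
Definition cmod z : R := complex.Re `|z|.

Lemma cmodE z : `|z| = real_complex R (cmod z).
Proof. by rewrite /cmod normc_def. Qed.

Lemma cmod_ge0 z : 0 <= cmod z.
Proof. by rewrite /cmod normc_def sqrtr_ge0. Qed.

Lemma cmodM z1 z2 : cmod (z1 * z2) = cmod z1 * cmod z2.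
Proof.
apply: (@complexI R); rewrite -cmodE normrM !cmodE.
by rewrite (rmorphM (real_complex R)).
Qed.

Lemma cmodD z1 z2 : cmod (z1 + z2) <= cmod z1 + cmod z2.
Proof. by rewrite -lecR (rmorphD (real_complex R)) /= -!cmodE ler_normD. Qed.

Lemma cmod0 : cmod 0 = 0. Proof. by rewrite /cmod normr0. Qed.

Lemma cmod1 : cmod 1 = 1. Proof. by rewrite /cmod normr1. Qed.

Lemma cmodN z : cmod (- z) = cmod z. Proof. by rewrite /cmod normrN. Qed.

Lemma cmodB z1 z2 : cmod (z1 - z2) = cmod (z2 - z1).
Proof. by rewrite -cmodN opprB. Qed.

Lemma cmod_eq0 z : cmod z = 0 -> z = 0.
Proof. by move=> z0; apply/eqP; rewrite -normr_eq0 cmodE z0. Qed.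

Lemma cmod_gt0 z : z <> 0 -> 0 < cmod z.
Proof.
by move=> z0; rewrite lt0r cmod_ge0 andbT; apply/eqP => /cmod_eq0.
Qed.

Lemma cmod_real (x : R) : cmod (real_complex R x) = `|x|.
Proof. by rewrite /cmod normc_def /= expr0n /= addr0 sqrtr_sqr. Qed.

Lemma cmodX z n : cmod (z ^+ n) = cmod z ^+ n.
Proof. by elim: n => [|n IH]; rewrite ?expr0 ?cmod1// !exprS cmodM IH. Qed.

Lemma cmod_triangle z2 z1 z3 : cmod (z1 - z3) <= cmod (z1 - z2) + cmod (z2 - z3).
Proof. by rewrite (le_trans _ (cmodD _ _))// addrA subrK. Qed.

Lemma cmod_unit z : `|z| = 1 -> cmod z = 1.
Proof. by rewrite /cmod => ->. Qed.

Lemma unit_cmod z : cmod z = 1 -> `|z| = 1.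
Proof. by rewrite cmodE => ->. Qed.

Lemma cmod_Re z : `|complex.Re z| <= cmod z.
Proof. by rewrite -lecR -cmodE normc_ge_Re. Qed.

Lemma cmod_Im z : `|complex.Im z| <= cmod z.
Proof.
rewrite /cmod normc_def /= -sqrtr_sqr ler_wsqrtr// lerDr.
by rewrite sqr_ge0.
Qed.

Lemma cmod_le_ReIm z : cmod z <= `|complex.Re z| + `|complex.Im z|.
Proof.
rewrite {1}[z]complexE (le_trans (cmodD _ _))// cmodM !cmod_real.
suff -> : cmod 'i%C = 1 by rewrite mul1r.
by rewrite /cmod normc_def /= expr0n expr1n /= add0r sqrtr1.
Qed.

Lemma complex_ReB z1 z2 : complex.Re (z1 - z2) = complex.Re z1 - complex.Re z2.
Proof. by case: z1 z2 => [a b] [c d]. Qed.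

Lemma complex_ImB z1 z2 : complex.Im (z1 - z2) = complex.Im z1 - complex.Im z2.
Proof. by case: z1 z2 => [a b] [c d]. Qed.

Lemma cmod_exp_sub1 z n : cmod z = 1 -> cmod (z ^+ n - 1) <= n%:R * cmod (z - 1).
Proof.
move=> z1; elim: n => [|n IH]; first by rewrite expr0 subrr cmod0 mul0r.
rewrite (le_trans (cmod_triangle (z ^+ n) _ _))//.
have -> : z ^+ n.+1 - z ^+ n = z ^+ n * (z - 1) by rewrite mulrBr mulr1 exprSr.
rewrite cmodM cmodX z1 expr1n mul1r -natr1 mulrDl mul1r addrC.
exact: lerD.
Qed.

(** As long as [|y - 1| < 1/2], squaring multiplies the distance to [1] by
[|y + 1| >= 3/2], so the distances of the [z ^ (2 ^ n)] to [1] cannot all stay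
below [1/2]. *)
Lemma cmod_far_power z : cmod z = 1 -> z <> 1 ->
  exists j, 2^-1 <= cmod (z ^+ j - 1).
Proof.
move=> z1 /eqP; rewrite -subr_eq0 => /eqP zN1; apply: contrapT => far.
have near j : cmod (z ^+ j - 1) < 2^-1.
  by rewrite ltNge; apply/negP => ?; apply: far; exists j.
have grow n : (3 / 2) ^+ n * cmod (z - 1) <= cmod (z ^+ (2 ^ n) - 1).
  elim: n => [|n IH]; first by rewrite expr0 mul1r expn0 expr1.
  have -> : z ^+ (2 ^ n.+1) - 1 = (z ^+ (2 ^ n) - 1) * (2 + (z ^+ (2 ^ n) - 1)).
    by rewrite expnS mulnC exprM; ring.
  rewrite cmodM exprS -mulrA mulrC; apply: ler_pM => //.
    exact/mulr_ge0/cmod_ge0/exprn_ge0.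
  have := cmodD (2 + (z ^+ (2 ^ n) - 1)) (- (z ^+ (2 ^ n) - 1)).
  rewrite addrK cmodN.
  have -> : cmod (2 : C) = 2.
    by rewrite (_ : (2 : C) = real_complex R 2) ?cmod_real ?ger0_norm ?rmorph_nat.
  by have := near (2 ^ n)%N; lra.
have d0 := cmod_gt0 zN1.
(* Bernoulli's inequality turns the geometric growth into a contradiction at
this explicit index. *)
pose n := (Num.truncn (cmod (z - 1))^-1).+1.
have /(_ n) := grow.
have bern k : 1 + k%:R / 2 <= (3 / 2 : R) ^+ k.
  elim: k => [|k IH]; first by rewrite expr0 mul0r addr0.
  rewrite exprS -natr1; have := ler0n R k; move: IH; nra.
have nlt : (cmod (z - 1))^-1 < n%:R by rewrite /n truncnS_gt.
have nd : 1 < n%:R * cmod (z - 1) by rewrite -ltr_pdivrMr// div1r.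
have := near (2 ^ n)%N.
have := bern n; have := ler0n R n.
set a := cmod (z - 1) in d0 nd *; set b := cmod _.
set c := (3 / 2) ^+ n; set m := n%:R in nd *.
move=> m0 mc b2 ab.
have : (1 + m / 2) * a <= c * a by rewrite ler_wpM2r// ltW.
nra.
Qed.

End Modulus.

(** * Limits of complex sequences *)

Section ComplexLimits.
Variable R : realType.
Local Notation C := R[i].

Lemma inv_succ_small (e : R) : 0 < e ->
  exists N, forall n, (N <= n)%N -> n.+1%:R^-1 <= e.
Proof.
move=> e0; exists (Num.truncn e^-1) => n Nn.
rewrite -[leRHS]invrK lef_pV2 ?posrE ?invr_gt0//.
by rewrite (le_trans (ltW (truncnS_gt _)))// ler_nat.
Qed.

Lemma exp2_gt (x : R) : exists n, x <= 2 ^+ n.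
Proof.
exists (Num.truncn x).+1; apply: ltW; rewrite (lt_le_trans (truncnS_gt x))//.
by rewrite -natrX ler_nat ltnW// ltn_expl.
Qed.

Lemma cauchy_real_limit (u : nat -> R) :
  (forall e, 0 < e -> exists N, forall m n, (N <= m)%N -> (N <= n)%N ->
     `|u m - u n| <= e) ->
  exists l, forall e, 0 < e -> exists N, forall n, (N <= n)%N -> `|u n - l| <= e.
Proof.
move=> uc.
have /cvg_ex[l ul] : cvgn u.
  apply/cauchy_cvgP/cauchy_exP => e e0.
  have [|N uN] := uc (e / 2); first by rewrite divr_gt0.
  exists (u N), N => //= n Nn; rewrite -ball_normE /ball_/=.
  by rewrite (le_lt_trans (uN _ _ _ _))// ltr_pdivrMr// ltr_pMr// ltr1n.
exists l => e e0; have /cvgrPdist_le /(_ _ e0) [N _ uN] := ul.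
by exists N => n Nn; rewrite distrC; apply: uN.
Qed.

(** The real and imaginary parts are Cauchy sequences, and their limits
are the parts of the limit. *)
Lemma cauchy_complex_limit (u : nat -> C) :
  (forall e, 0 < e -> exists N, forall m n, (N <= m)%N -> (N <= n)%N ->
     cmod (u m - u n) <= e) ->
  exists l, forall e, 0 < e -> exists N, forall n, (N <= n)%N ->
    cmod (u n - l) <= e.
Proof.
move=> uc.
have [|a ua] := @cauchy_real_limit (fun n => complex.Re (u n)).
  move=> e /uc[N uN]; exists N => m n mN nN.
  by rewrite -complex_ReB (le_trans (cmod_Re _))// uN.
have [|b ub] := @cauchy_real_limit (fun n => complex.Im (u n)).
  move=> e /uc[N uN]; exists N => m n mN nN.
  by rewrite -complex_ImB (le_trans (cmod_Im _))// uN.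
exists (Complex a b) => e e0.
have [|N1 uN1] := ua (e / 2); first by rewrite divr_gt0.
have [|N2 uN2] := ub (e / 2); first by rewrite divr_gt0.
exists (maxn N1 N2) => n; rewrite geq_max => /andP[n1 n2].
rewrite (le_trans (cmod_le_ReIm _))// complex_ReB complex_ImB /=.
by have := uN1 _ n1; have := uN2 _ n2; lra.
Qed.

Lemma cmod_limit_le (u : nat -> C) (l z : C) (r : R) :
  (forall e, 0 < e -> exists N, forall n, (N <= n)%N -> cmod (u n - l) <= e) ->
  (exists N, forall n, (N <= n)%N -> cmod (z - u n) <= r) -> cmod (z - l) <= r.
Proof.
move=> ul [N uN]; apply/ler_addgt0Pr => e /ul[N' uN'].
rewrite (le_trans (cmod_triangle (u (maxn N N')) _ _))// lerD//.
  by rewrite uN ?leq_maxl.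
by rewrite uN' ?leq_maxr.
Qed.

End ComplexLimits.

(** * Characters *)

Section Characters.
Variables (R : realType) (G : zmodType).
Local Notation C := R[i].
Implicit Types (chi psi : G -> C) (g h : G).

Lemma char_cmod chi h : character chi -> cmod (chi h) = 1.
Proof. by move=> [+ _] => /(_ h) /cmod_unit. Qed.

Lemma char_neq0 chi h : character chi -> chi h != 0.
Proof. by move=> [+ _] => /(_ h) chi1; rewrite -normr_eq0 chi1 oner_eq0. Qed.

Lemma charD chi g h : character chi -> chi (g + h) = chi g * chi h.
Proof. by move=> [_]; apply. Qed.

Lemma char0 chi : character chi -> chi 0 = 1.
Proof.
move=> chic; apply: (mulfI (char_neq0 0 chic)).
by rewrite -charD// addr0 mulr1.
Qed.

Lemma charN chi h : character chi -> chi (- h) = (chi h)^-1.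
Proof.
move=> chic; apply: (mulfI (char_neq0 h chic)).
by rewrite -charD// subrr char0// divff// char_neq0.
Qed.

Lemma charB chi g h : character chi -> chi (g - h) = chi g / chi h.
Proof. by move=> chic; rewrite charD// charN. Qed.

Lemma charMn chi h n : character chi -> chi (h *+ n) = chi h ^+ n.
Proof.
move=> chic; elim: n => [|n IH]; first by rewrite mulr0n expr0 char0.
by rewrite mulrS charD// IH exprS.
Qed.

Lemma characterM chi psi :
  character chi -> character psi -> character (fun h => chi h * psi h).
Proof.
move=> [chi1 chiD] [psi1 psiD]; split=> [h|g h].
  by rewrite normrM chi1 psi1 mulr1.
by rewrite chiD psiD mulrACA.
Qed.

Lemma characterV chi : character chi -> character (fun h => (chi h)^-1).
Proof.
move=> [chi1 chiD]; split=> [h|g h]; first by rewrite normfV chi1 invr1.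
by rewrite chiD invfM.
Qed.

Lemma characterX chi n : character chi -> character (fun h => chi h ^+ n).
Proof.
move=> [chi1 chiD]; split=> [h|g h]; first by rewrite normrX chi1 expr1n.
by rewrite chiD exprMn.
Qed.

Lemma character1 : character (trivial_character R G).
Proof. by split=> *; rewrite /trivial_character ?normr1 ?mulr1. Qed.

Lemma char_nontrivial chi : chi <> trivial_character R G ->
  exists h, chi h <> 1.
Proof.
move=> chi1; apply: contrapT => allchi; apply: chi1; apply/funext => h.
by apply: contrapT => hchi; apply: allchi; exists h.
Qed.

Lemma char_sub1D chi g h : character chi ->
  cmod (chi (g + h) - 1) <= cmod (chi g - 1) + cmod (chi h - 1).
Proof.
move=> chic; rewrite (le_trans (cmod_triangle (chi g) _ _))// charD//.
have -> : chi g * chi h - chi g = chi g * (chi h - 1) by rewrite mulrBr mulr1.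
by rewrite cmodM char_cmod// mul1r addrC.
Qed.

Lemma char_sub1N chi h : character chi -> cmod (chi (- h) - 1) = cmod (chi h - 1).
Proof.
move=> chic; rewrite -[RHS]mul1r -[in RHS](char_cmod (- h) chic) -cmodM mulrBr.
by rewrite charN// mulVf ?char_neq0// mulr1 cmodB.
Qed.

Lemma char_sub1Mn chi h n : character chi ->
  cmod (chi (h *+ n) - 1) <= n%:R * cmod (chi h - 1).
Proof. by move=> chic; rewrite charMn// cmod_exp_sub1// char_cmod. Qed.

(** Translation invariance: the distance between two characters at [h] is the
distance to [1] of their quotient. *)
Lemma char_subr chi psi h : character psi ->
  cmod (chi h - psi h) = cmod (chi h / psi h - 1).
Proof.
move=> psic; rewrite -[RHS]mul1r -[in RHS](char_cmod h psic) -cmodM mulrBr mulr1.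
by rewrite mulrC divfK ?char_neq0.
Qed.

End Characters.

(** * Eigenvectors in separable spaces *)

Section OperatorNorms.
Variable R : realType.
Local Notation C := R[i].
Implicit Types X : normedModType C.

Definition rnorm X (x : X) : R := complex.Re `|x|.

Lemma rnormE X (x : X) : `|x| = real_complex R (rnorm x).
Proof. by rewrite /rnorm RRe_real. Qed.

Lemma rnorm_ge0 X (x : X) : 0 <= rnorm x.
Proof. by rewrite -ler0c -rnormE normr_ge0. Qed.

Lemma rnorm_eq0 X (x : X) : rnorm x = 0 -> x = 0.
Proof. by move=> x0; apply/eqP; rewrite -normr_eq0 rnormE x0. Qed.

Lemma rnormZ X (a : C) (x : X) : rnorm (a *: x) = cmod a * rnorm x.
Proof.
apply: (@complexI R); rewrite -rnormE normrZ cmodE rnormE.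
by rewrite (rmorphM (real_complex R)).
Qed.

Lemma rnormD X (x y : X) : rnorm (x + y) <= rnorm x + rnorm y.
Proof. by rewrite -lecR (rmorphD (real_complex R)) /= -!rnormE ler_normD. Qed.

Lemma rnormB X (x y : X) : rnorm (x - y) = rnorm (y - x).
Proof. by rewrite /rnorm distrC. Qed.

Lemma rnorm_unit X (x : X) : x != 0 ->
  rnorm (real_complex R (rnorm x)^-1 *: x) = 1.
Proof.
move=> x0; have nx0 : rnorm x != 0 by apply: contra_neq x0 => /rnorm_eq0.
by rewrite rnormZ cmod_real ger0_norm ?invr_ge0 ?rnorm_ge0// mulVf.
Qed.

Lemma linear_at0 X (T : X -> X) : linear T -> T 0 = 0.
Proof. by move=> /(_ (-1) 0 0); rewrite scaler0 addr0 scaleN1r addNr. Qed.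

(** The operator norm only sees the unit ball, so [x] is first normalised. *)
Lemma opnorm_le X (T : X -> X) (M : R) : linear T -> (opnorm T <= M%:E)%E ->
  forall x, rnorm (T x) <= M * rnorm x.
Proof.
move=> linT TM x.
have TZ a y : T (a *: y) = a *: T y.
  by have := linT a y 0; rewrite !addr0 linear_at0// addr0.
have [->|x0] := eqVneq x 0.
  by rewrite linear_at0// /rnorm normr0 mulr0.
have nx_gt0 : 0 < rnorm x.
  by rewrite lt0r rnorm_ge0 andbT; apply: contra_neq x0 => /rnorm_eq0.
have : ((rnorm (T (real_complex R (rnorm x)^-1 *: x)))%:E <= M%:E)%E.
  apply: le_trans TM; apply: ereal_sup_ubound.
  by exists (real_complex R (rnorm x)^-1 *: x) => //=; rewrite rnormE rnorm_unit// lexx.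
rewrite lee_fin TZ rnormZ cmod_real ger0_norm ?invr_ge0 ?rnorm_ge0//.
by rewrite mulrC ler_pdivrMr.
Qed.

Lemma opnorm_ubound X (T : X -> X) (M : R) : 0 <= M ->
  (forall x, rnorm (T x) <= M * rnorm x) -> (opnorm T <= M%:E)%E.
Proof.
move=> M0 TM; apply: ge_ereal_sup => _ [x /= x1 <-]; rewrite lee_fin.
rewrite (le_trans (TM x))// ler_piMr//.
by rewrite -lecR -rnormE.
Qed.

(** Each [e a] has a point of a countable dense set within [d / 2], and these
points differ for different [a]. *)
Lemma separated_countable (T : Type) (A : set T) X (e : T -> X) (d : R) :
  Defs.separable X -> 0 < d ->
  (forall a b, A a -> A b -> a <> b -> d <= rnorm (e a - e b)) -> countable A.
Proof.
move=> [D /countable_injP[f finj] Dd] d0 esep.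
have near a : exists x, D x /\ rnorm (e a - x) < d / 2.
  have d2 : 0 < real_complex R (d / 2) by rewrite ltcR divr_gt0.
  have [||x] := Dd (ball (e a) (real_complex R (d / 2))).
  - by exists (e a); exact: ballxx.
  - exact: ball_open.
  - rewrite -ball_normE /= => -[/= eax Dx]; exists x; split=> //.
    by rewrite -ltcR -rnormE.
have [x xP] := choice near.
apply/countable_injP; exists (f \o x) => a b; rewrite !inE => Aa Ab /= fab.
have xab : x a = x b by apply: finj => //; rewrite inE; apply: (xP _).1.
apply: contrapT => /(esep _ _ Aa Ab); apply/negP; rewrite -ltNge.
have -> : e a - e b = (e a - x a) + (x b - e b) by rewrite xab addrA subrK.
rewrite (le_lt_trans (rnormD _ _))// (rnormB (x b)).
by have := (xP a).2; have := (xP b).2; lra.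
Qed.

(** Unit eigenvectors [e], [f] for [chi] and [psi] satisfy
[(chi h - psi h) f = rho h (e - f) + chi h (f - e)], whence
[|chi h - psi h| <= (M + 1) ||e - f||] for [h] in [S]. Since [S] distinguishes
[chi / psi] from [1] by [eps], the eigenvectors are uniformly separated. *)
Lemma separating_spectrum_countable (G : zmodType) (X : completeNormedModType C)
    (rho : G -> X -> X) (S : set G) (M eps : R) :
  representation rho -> 0 < eps ->
  (forall h, S h -> (opnorm (rho h) <= M%:E)%E) ->
  (forall chi : G -> C, character chi -> chi <> trivial_character R G ->
     exists2 h, S h & eps <= cmod (chi h - 1)) ->
  countable (unimodular_point_spectrum rho).
Proof.
move=> [sepX _ GLrho _] eps0 SM Seps.
have ev chi : exists e : X, unimodular_point_spectrum rho chi ->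
    rnorm e = 1 /\ forall h, rho h e = chi h *: e.
  have [[chic [e e0 eP]]|] :=
      pselect (unimodular_point_spectrum rho chi); last by exists 0.
  exists (real_complex R (rnorm e)^-1 *: e) => _; split; first exact: rnorm_unit.
  move=> h; have [[linT _] _] := GLrho h.
  have := linT (real_complex R (rnorm e)^-1) e 0.
  rewrite !addr0 linear_at0// addr0 eP => ->.
  by rewrite !scalerA mulrC.
have {ev}[e eP] := choice ev.
pose d := eps / (`|M| + 1).
have M1 : 0 < `|M| + 1 by rewrite ltr_wpDl.
apply: (@separated_countable _ _ _ e d sepX) => [|chi psi Sc Sp cp].
  by rewrite divr_gt0.
have [[chic _] [psic _]] := (Sc, Sp).
have [_ eigchi] := eP _ Sc; have [psi1 eigpsi] := eP _ Sp.
have [|h Sh] := Seps _ (characterM chic (characterV psic)).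
  move=> /(congr1 (fun f h => f h * psi h)) eqcp; apply: cp; apply/funext => h.
  have /= := congr1 (fun f => f h) eqcp.
  by rewrite divfK ?char_neq0// /trivial_character mul1r.
rewrite -(char_subr _ _ psic) => epsh.
rewrite ler_pdivrMr// (le_trans epsh)//.
have [[linT _] _] := GLrho h.
have Tb := opnorm_le linT (SM h Sh).
have TB x y : rho h (x - y) = rho h x - rho h y.
  have := linT (-1) y x; rewrite !scaleN1r (addrC (- y)) => ->.
  by rewrite addrC.
have : cmod (chi h - psi h) = rnorm ((chi h - psi h) *: e psi).
  by rewrite rnormZ psi1 mulr1.
have -> : (chi h - psi h) *: e psi =
    rho h (e chi - e psi) + chi h *: (e psi - e chi).
  by rewrite TB eigchi eigpsi scalerBl scalerBr [RHS]addrC [RHS]addrA subrK.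
move=> ->; rewrite (le_trans (rnormD _ _))// rnormZ (char_cmod h chic) mul1r.
rewrite mulrDr mulr1 (rnormB (e psi)) lerD// (le_trans (Tb _))// mulrC.
by rewrite ler_wpM2l ?rnorm_ge0// ler_norm.
Qed.

End OperatorNorms.

(** * Closed spans in weighted sup norms *)

Section WeightedSpan.
Variables (R : realType) (T : Type) (w : T -> {posnum R}) (u : nat -> T -> R[i]).
Local Notation C := R[i].
Implicit Types (x y : T -> C) (s : seq (C * nat)).

Definition lincomb s (h : T) : C := \sum_(p <- s) p.1 * u p.2 h.

Definition weight_bounded x := exists M : R, forall h, cmod (x h) <= M * (w h)%:num.

Definition in_weighted_closure x := forall e : R, 0 < e ->
  exists s, forall h, cmod (x h - lincomb s h) <= e * (w h)%:num.

(** Boundedness is part of the definition so that the weighted sup norm is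
finite whatever the family [u] is. *)
Definition weighted_span_pred : {pred T -> C} :=
  mem [set x | weight_bounded x /\ in_weighted_closure x].

Lemma weighted_spanP x : reflect (weight_bounded x /\ in_weighted_closure x)
  (x \in weighted_span_pred).
Proof. by apply: (iffP idP); rewrite inE. Qed.

Lemma lincombZ a s h :
  lincomb [seq (a * p.1, p.2) | p <- s] h = a * lincomb s h.
Proof.
by rewrite /lincomb big_map mulr_sumr; apply: eq_bigr => p _; rewrite mulrA.
Qed.

Lemma lincomb_cat s1 s2 h : lincomb (s1 ++ s2) h = lincomb s1 h + lincomb s2 h.
Proof. by rewrite /lincomb big_cat. Qed.

Lemma weighted_span_closed : submod_closed weighted_span_pred.
Proof.
split=> [|a x y].
  apply/weighted_spanP; split=> [|e e0].
    by exists 0 => h; rewrite cmod0 mul0r.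
  by exists [::] => h; rewrite /lincomb big_nil subrr cmod0 mulr_ge0// ltW.
move=> /weighted_spanP[[M xM] xs] /weighted_spanP[[N yN] ys].
apply/weighted_spanP; split=> [|e e0].
  exists (cmod a * M + N) => h.
  rewrite (le_trans (cmodD _ _))// mulrDl lerD// cmodM -mulrA.
  by rewrite ler_wpM2l// cmod_ge0.
have a1 : 0 < cmod a + 1 by rewrite ltr_wpDl// cmod_ge0.
have [|s sx] := xs (e / 2 / (cmod a + 1)); first by rewrite !divr_gt0.
have [|t ty] := ys (e / 2); first by rewrite divr_gt0.
exists ([seq (a * p.1, p.2) | p <- s] ++ t) => h; rewrite lincomb_cat lincombZ.
have -> : (a *: x + y) h - (a * lincomb s h + lincomb t h)
    = a * (x h - lincomb s h) + (y h - lincomb t h).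
  by rewrite mulrBr opprD addrACA.
rewrite (le_trans (cmodD _ _))//.
rewrite [e in leRHS]splitr mulrDl lerD// cmodM.
rewrite (le_trans (ler_wpM2l (cmod_ge0 _) (sx h)))// mulrA ler_wpM2r//.
rewrite mulrCA ler_piMr// ?divr_ge0 ?ltW//.
by rewrite ltr_pdivrMr// mul1r ltrDl.
Qed.

HB.instance Definition _ :=
  GRing.isSubmodClosed.Build C (T -> C) weighted_span_pred weighted_span_closed.

Definition weighted_span := {x : T -> C | x \in weighted_span_pred}.

HB.instance Definition _ := SubChoice.on weighted_span.
HB.instance Definition _ := [SubChoice_isSubLmodule of weighted_span by <:].

Definition weighted_norm x : R := sup [set cmod (x h) / (w h)%:num | h in [set: T]].

Lemma weighted_norm_ge0 x : 0 <= weighted_norm x.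
Proof.
rewrite /weighted_norm; set S := [set _ | _ in _].
have [supS|/sup_out->//] := pselect (has_sup S).
have [[_ [h _ _]] ubS] := supS.
rewrite (@le_trans _ _ (cmod (x h) / (w h)%:num)) ?divr_ge0 ?cmod_ge0//.
by apply: ub_le_sup => //; exists h.
Qed.

Lemma weighted_norm_le x M : 0 <= M ->
  (forall h, cmod (x h) <= M * (w h)%:num) -> weighted_norm x <= M.
Proof.
move=> M0 xM; rewrite /weighted_norm; set S := [set _ | _ in _].
have [->|/set0P S0] := eqVneq S set0; first by rewrite sup0.
by apply: ge_sup => // _ [h _ <-]; rewrite ler_pdivrMr.
Qed.

Lemma le_weighted_norm x h : weight_bounded x ->
  cmod (x h) <= weighted_norm x * (w h)%:num.
Proof.
move=> [M xM]; rewrite -ler_pdivrMr//; apply: ub_le_sup; last by exists h.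
by exists M => _ [k _ <-]; rewrite ler_pdivrMr.
Qed.

Lemma span_bounded (x : weighted_span) : weight_bounded (val x).
Proof. by have /weighted_spanP[] := valP x. Qed.

Definition span_norm (x : weighted_span) : C := real_complex R (weighted_norm (val x)).

Lemma span_normD (x y : weighted_span) : span_norm (x + y) <= span_norm x + span_norm y.
Proof.
rewrite /span_norm -(rmorphD (real_complex R)) lecR.
apply: weighted_norm_le => [|h]; first by rewrite addr_ge0 ?weighted_norm_ge0.
rewrite (le_trans (cmodD _ _))// mulrDl.
by apply: lerD; apply/le_weighted_norm/span_bounded.
Qed.

(** One inequality is enough: applied to [a^-1] it gives the converse one. *)
Lemma weighted_normZ_le (a : C) x : weight_bounded x ->
  weighted_norm (a *: x) <= cmod a * weighted_norm x.
Proof.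
move=> xb; apply: weighted_norm_le => [|h].
  by rewrite mulr_ge0 ?weighted_norm_ge0 ?cmod_ge0.
by rewrite cmodM -mulrA ler_wpM2l ?cmod_ge0 ?le_weighted_norm.
Qed.

Lemma span_normZ (a : C) (x : weighted_span) : span_norm (a *: x) = `|a| * span_norm x.
Proof.
rewrite /span_norm cmodE -(rmorphM (real_complex R)); congr (real_complex R _).
have xb := span_bounded x; apply/eqP; rewrite eq_le; apply/andP; split.
  exact: weighted_normZ_le.
have [->|a0] := eqVneq a 0.
  by rewrite cmod0 mul0r weighted_norm_ge0.
have ca0 : 0 < cmod a by apply: cmod_gt0; apply/eqP.
rewrite mulrC -ler_pdivlMr// mulrC.
have := weighted_normZ_le a^-1 (span_bounded (a *: x)).
rewrite [X in weighted_norm X](_ : _ = val x); last first.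
  by apply/funext => h /=; rewrite scalerA mulVf// scale1r.
suff -> : cmod a^-1 = (cmod a)^-1 by [].
apply: (mulfI (lt0r_neq0 ca0)).
by rewrite -cmodM !divff ?cmod1// gt_eqF.
Qed.

Lemma span_norm0_eq0 (x : weighted_span) : span_norm x = 0 -> x = 0.
Proof.
move=> /(@complexI R) x0; apply/val_inj/funext => h.
apply: cmod_eq0; apply/eqP; rewrite eq_le cmod_ge0 andbT.
by rewrite (le_trans (le_weighted_norm h (span_bounded x)))// x0 mul0r.
Qed.

HB.instance Definition _ := Lmodule_isNormed.Build C weighted_span
  span_normD span_normZ span_norm0_eq0.

Lemma weighted_rnorm (x : weighted_span) : rnorm x = weighted_norm (val x).
Proof. by []. Qed.

End WeightedSpan.

Section WeightedSpanBanach.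
Variables (R : realType) (T : Type) (w : T -> {posnum R}) (u : nat -> T -> R[i]).
Local Notation C := R[i].
Local Notation X := (weighted_span w u).

Lemma span_val_le (x y : X) h :
  cmod (val x h - val y h) <= rnorm (x - y) * (w h)%:num.
Proof. exact: (le_weighted_norm h (span_bounded (x - y))). Qed.

Lemma rnorm_span_le (x y : X) (e : R) : 0 <= e ->
  (forall h, cmod (val x h - val y h) <= e * (w h)%:num) -> rnorm (x - y) <= e.
Proof. by move=> e0 xy; apply: weighted_norm_le. Qed.

(** The members of a Cauchy filter yield a sequence that is Cauchy for the norm;
it converges pointwise, at a rate uniform with respect to the weight, so its
pointwise limit is again in the closed span and is the limit in norm. *)
Lemma weighted_span_complete (F : set_system X) :
  ProperFilter F -> cauchy F -> cvg F.
Proof.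
move=> FF /cauchyP Fc.
have eps_gt0 n : 0 < real_complex R n.+1%:R^-1 by rewrite ltcR invr_gt0 ltr0n.
have [x xF] := choice (fun n => Fc _ (eps_gt0 n)).
have ball_rnorm (a b : X) (e : R) : ball a (real_complex R e) b -> rnorm (a - b) < e.
  by rewrite -ball_normE /= rnormE ltcR.
have xc m n : rnorm (x m - x n) <= m.+1%:R^-1 + n.+1%:R^-1.
  have [y [/ball_rnorm ym /ball_rnorm yn]] := filter_ex (filterI (xF m) (xF n)).
  rewrite -(subrK y (x m)) -addrA (le_trans (rnormD _ _))//.
  by rewrite (rnormB y) lerD// ltW.
have xcauchy (e : R) : 0 < e -> exists N, forall m n, (N <= m)%N -> (N <= n)%N ->
    rnorm (x m - x n) <= e.
  move=> e0; have [|N NP] := @inv_succ_small R (e / 2); first by rewrite divr_gt0.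
  exists N => m n /NP mN /NP nN.
  by rewrite (le_trans (xc m n))// (splitr e) lerD.
have lim h : exists l, forall e : R, 0 < e -> exists N, forall n, (N <= n)%N ->
    cmod (val (x n) h - l) <= e.
  apply: cauchy_complex_limit => e e0.
  have [|N NP] := xcauchy (e / (w h)%:num); first by rewrite divr_gt0.
  exists N => m n Nm Nn; rewrite (le_trans (span_val_le _ _ _))//.
  by rewrite -ler_pdivlMr// NP.
have [l lP] := choice lim.
have xl (e : R) : 0 < e -> exists N, forall n h, (N <= n)%N ->
    cmod (val (x n) h - l h) <= e * (w h)%:num.
  move=> /xcauchy[N NP]; exists N => n h Nn.
  apply: (cmod_limit_le (lP h)); exists N => m Nm.
  rewrite (le_trans (span_val_le _ _ _))// ler_wpM2r//; exact: NP.
have lX : l \in weighted_span_pred w u.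
  apply/weighted_spanP; split=> [|e e0].
    have [N NP] := xl 1 ltr01; have [M xM] := span_bounded (x N).
    exists (1 + M) => h; rewrite -(subrK (val (x N) h) (l h)).
    by rewrite (le_trans (cmodD _ _))// mulrDl lerD// cmodB NP.
  have e2 : 0 < e / 2 by rewrite divr_gt0.
  have [N NP] := xl _ e2.
  have /weighted_spanP[_ /(_ _ e2)[s sP]] := valP (x N).
  exists s => h; rewrite (le_trans (cmod_triangle (val (x N) h) _ _))//.
  by rewrite (splitr e) mulrDl lerD// cmodB NP.
apply/cvg_ex; exists (exist _ l lX); apply/cvgrPdist_le => /= e e0.
have eE : e = real_complex R (complex.Re e).
  by rewrite RRe_real// gtr0_real.
have {}e0 : 0 < complex.Re e / 2 by rewrite divr_gt0// -ltcR -eE.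
have [N1 N1P] := inv_succ_small e0; have [N2 N2P] := xl _ e0.
pose n := maxn N1 N2.
apply: filterS (xF n) => y /ball_rnorm xy.
rewrite rnormE eE lecR (splitr (complex.Re e)).
rewrite -(subrK (x n) (exist _ l lX)) -addrA (le_trans (rnormD _ _))// lerD//.
  apply: rnorm_span_le; first exact: ltW.
  by move=> h; rewrite cmodB N2P// leq_maxr.
by rewrite (le_trans (ltW xy))// N1P// leq_maxl.
Qed.

HB.instance Definition _ := Uniform_isComplete.Build X weighted_span_complete.

Hypothesis uw : forall n h, cmod (u n h) <= (w h)%:num.

Lemma lincomb_in_span s : lincomb u s \in weighted_span_pred w u.
Proof.
apply/weighted_spanP; split=> [|e e0]; last first.
  by exists s => h; rewrite subrr cmod0 mulr_ge0// ltW.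
exists (\sum_(p <- s) cmod p.1) => h; rewrite /lincomb.
elim: s => [|p s IH]; first by rewrite !big_nil cmod0 mul0r.
rewrite !big_cons (le_trans (cmodD _ _))// mulrDl lerD//.
by rewrite cmodM ler_wpM2l ?cmod_ge0.
Qed.

Definition span_lincomb s : X := exist _ (lincomb u s) (lincomb_in_span s).

Definition rat_complex (q : rat * rat) : C := Complex (ratr q.1) (ratr q.2).

Lemma rat_complex_near (z : C) (e : R) : 0 < e ->
  exists q, cmod (z - rat_complex q) <= e.
Proof.
have near (a d : R) : 0 < d -> exists q : rat, `|a - ratr q| <= d.
  move=> d0; have [|q] := @rat_in_itvoo R (a - d) (a + d); first by lra.
  rewrite in_itv /= => /andP[q1 q2]; exists q.
  by rewrite ler_distl; apply/andP; split; lra.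
move=> e0; have e2 : 0 < e / 2 by rewrite divr_gt0.
case: z => a b; have [[q qa] [r rb]] := (near a _ e2, near b _ e2).
exists (q, r); rewrite (le_trans (cmod_le_ReIm _))//=.
by rewrite (splitr e); apply: lerD.
Qed.

Definition rat_coefs (s : seq ((rat * rat) * nat)) : seq (C * nat) :=
  [seq (rat_complex p.1, p.2) | p <- s].

Lemma rat_lincomb_near s (e : R) : 0 < e -> exists t, forall h,
  cmod (lincomb u s h - lincomb u (rat_coefs t) h) <= e * (w h)%:num.
Proof.
elim: s e => [|[a n] s IH] e e0.
  exists [::] => h.
  by rewrite /lincomb !big_nil subrr cmod0 mulr_ge0// ltW.
have e2 : 0 < e / 2 by rewrite divr_gt0.
have [[t tP] [q qP]] := (IH _ e2, rat_complex_near a e2).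
exists ((q, n) :: t) => h; rewrite /lincomb /= !big_cons /= opprD addrACA -mulrBl.
rewrite (le_trans (cmodD _ _))// (splitr e) [leRHS]mulrDl.
apply: lerD; last exact: tP.
by rewrite cmodM; apply: ler_pM; rewrite ?cmod_ge0.
Qed.

(** Linear combinations with coefficients in [Q + iQ] are countably many, and
they are dense because the [u n] are bounded by the weight. *)
Lemma weighted_span_separable : Defs.separable X.
Proof.
exists (range (fun t => span_lincomb (rat_coefs t))).
  exact: (sub_countable (card_image_le _ _) (countableP _)).
move=> O [x Ox] openO.
have /nbhs_ballP[e /= e0 eO] := open_nbhs_nbhs (conj openO Ox).
have eE : e = real_complex R (complex.Re e).
  by rewrite RRe_real// gtr0_real.
have {}e0 : 0 < complex.Re e by rewrite -ltcR -eE.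
have e4 : 0 < complex.Re e / 4 by rewrite divr_gt0.
have /weighted_spanP[_ /(_ _ e4)[s sP]] := valP x.
have [t tP] := rat_lincomb_near s e4.
exists (span_lincomb (rat_coefs t)); split; last by exists t.
apply: eO; rewrite -ball_normE /= rnormE eE ltcR.
apply: (@le_lt_trans _ _ (complex.Re e / 2)); last first.
  by rewrite ltr_pdivrMr// ltr_pMr// ltr1n.
apply: rnorm_span_le => [|h]; first by rewrite divr_ge0// ltW.
rewrite (le_trans (cmod_triangle (lincomb u s h) _ _))//.
have := sP h; have := tP h; rewrite /=; lra.
Qed.

End WeightedSpanBanach.

(** * The translation representation *)

Section Independence.
Variables (R : realType) (G : zmodType).
Local Notation C := R[i].

(** Artin's argument: if [g] separates the characters of index [i] and [m], then
comparing the relation at [h + g] with [chi_m g] times the relation at [h]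
eliminates [chi_m] and leaves a shorter relation. *)
Lemma characters_independent m (chi : 'I_m -> G -> C) (a : 'I_m -> C) :
  (forall i, character (chi i)) -> injective chi ->
  (forall h, \sum_i a i * chi i h = 0) -> forall i, a i = 0.
Proof.
elim: m chi a => [|m IH] chi a chic chiI sum0; first by case.
pose W := widen_ord (leqnSn m).
have a0 i : a (W i) = 0.
  have [g /eqP cg] : (exists g, chi (W i) g <> chi ord_max g).
    apply: contrapT => eqc; have eqWm : chi (W i) = chi ord_max.
      by apply/funext => g; apply: contrapT => ?; apply: eqc; exists g.
    by have := ltn_ord i; have /(congr1 val) /= -> := chiI _ _ eqWm; rewrite ltnn.
  have : a (W i) * (chi (W i) g - chi ord_max g) = 0.
    apply: (IH (chi \o W) (fun j => a (W j) * (chi (W j) g - chi ord_max g))).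
    - by move=> j; apply: chic.
    - move=> j k /chiI/(congr1 val) /= jk; exact: val_inj.
    move=> h; have := sum0 (h + g); have := sum0 h.
    rewrite !big_ord_recr /= => /eqP; rewrite addr_eq0 => /eqP s1.
    move=> /eqP; rewrite addr_eq0 => /eqP s2.
    transitivity (\sum_j a (W j) * chi (W j) (h + g) -
        chi ord_max g * \sum_j a (W j) * chi (W j) h).
      rewrite mulr_sumr -sumrB; apply: eq_bigr => j _.
      by rewrite /= charD//; ring.
    by rewrite s1 s2 charD//; ring.
  by move=> /eqP; rewrite mulf_eq0 subr_eq0 (negPf cg) orbF => /eqP.
have am : a ord_max = 0.
  have := sum0 0; rewrite big_ord_recr /= char0// mulr1 big1 ?add0r//.
  by move=> j _; rewrite a0 mul0r.
move=> i; case: (unliftP ord_max i) => [j ->|-> //].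
have -> : lift ord_max j = W j by apply: val_inj; rewrite /= /bump leqNgt ltn_ord.
exact: a0.
Qed.

End Independence.

Section Translation.
Variables (R : realType) (G : zmodType) (w : G -> {posnum R}).
Variables (u : nat -> G -> R[i]) (c : G -> R).
Local Notation C := R[i].
Local Notation X := (weighted_span w u).

Hypothesis char_u : forall n, character (u n).
Hypothesis w_ge1 : forall h, 1 <= (w h)%:num.
Hypothesis c_ge0 : forall g, 0 <= c g.
Hypothesis w_shift : forall g h, (w (h + g))%:num <= c g * (w h)%:num.

(** A translate of [u n] is a scalar multiple of [u n], so translation acts on
linear combinations of the [u n] through their coefficients, and the growth
bound on the weight lets it pass to the closure. *)
Lemma shift_in_span g (x : X) :
  (fun h => val x (h + g)) \in weighted_span_pred w u.
Proof.
have /weighted_spanP[[M xM] xs] := valP x; apply/weighted_spanP.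
have M0 : 0 <= M by have := le_trans (cmod_ge0 _) (xM 0); rewrite pmulr_lge0.
split=> [|e e0].
  exists (M * c g) => h; rewrite (le_trans (xM _))// -mulrA.
  by rewrite ler_wpM2l// w_shift.
have c1 : 0 < c g + 1 by rewrite ltr_wpDl.
have [|s sP] := xs (e / (c g + 1)); first by rewrite divr_gt0.
exists [seq (p.1 * u p.2 g, p.2) | p <- s] => h.
have -> : lincomb u [seq (p.1 * u p.2 g, p.2) | p <- s] h = lincomb u s (h + g).
  rewrite /lincomb big_map; apply: eq_bigr => p _ /=.
  by rewrite charD// -mulrA (mulrC (u _ g)).
rewrite (le_trans (sP _))//.
rewrite -mulrA ler_wpM2l ?(ltW e0)// ler_pdivrMl//.
by rewrite (le_trans (w_shift _ _))// ler_wpM2r// lerDl.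
Qed.

Definition translation g (x : X) : X :=
  exist _ (fun h => val x (h + g)) (shift_in_span g x).

Lemma translationD g h : translation (g + h) = translation g \o translation h.
Proof.
by apply/funext => x; apply/val_inj/funext => k /=; rewrite addrA.
Qed.

Lemma translation_linear g : linear (translation g).
Proof. by move=> a x y; apply/val_inj. Qed.

Lemma translation_opnorm g : (opnorm (translation g) <= (c g)%:E)%E.
Proof.
apply: opnorm_ubound => // x; apply: weighted_norm_le => [|h].
  by rewrite mulr_ge0 ?rnorm_ge0.
rewrite (le_trans (le_weighted_norm _ (span_bounded x)))//.
by rewrite weighted_rnorm (mulrC (c g)) -mulrA ler_wpM2l ?weighted_norm_ge0.
Qed.

Lemma translation_GL g : GL (translation g).
Proof.
have bnd k : bounded_operator (translation k).
  split; first exact: translation_linear.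
  by rewrite (le_lt_trans (translation_opnorm k))// ltry.
split=> //; exists (translation (- g)); split=> // x; apply/val_inj/funext => h /=.
  by rewrite subrK.
by rewrite addrK.
Qed.

Lemma character_eigenvector chi : character chi -> in_weighted_closure w u chi ->
  unimodular_point_spectrum translation chi.
Proof.
move=> chic chicl; split=> //.
have chiX : chi \in weighted_span_pred w u.
  apply/weighted_spanP; split=> //; exists 1 => h.
  by rewrite char_cmod// mul1r.
exists (exist _ chi chiX).
  apply/eqP => /(congr1 (fun x : X => val x 0)) /= /eqP.
  by apply/negP; exact: char_neq0.
by move=> g; apply/val_inj/funext => h /=; rewrite charD// mulrC.
Qed.

(** If [n] vectors spanned the space, the coordinates of [n + 1] of the characters
would form a matrix with a nonzero row kernel, that is a linear relation
between distinct characters. *)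
Lemma span_infinite_dimensional (chi : nat -> G -> C) :
  injective chi -> (forall n, character (chi n)) ->
  (forall n, in_weighted_closure w u (chi n)) -> infinite_dimensional X.
Proof.
move=> chiI chic chicl n e; apply: contrapT => espan.
have chiX k : chi k \in weighted_span_pred w u.
  apply/weighted_spanP; split=> //; exists 1 => h.
  by rewrite char_cmod// mul1r.
have coef k : exists a : 'I_n -> C, exist _ (chi k) (chiX k) = \sum_(i < n) a i *: e i.
  apply: contrapT => noa; apply: espan; exists (exist _ (chi k) (chiX k)) => a aP.
  by apply: noa; exists a.
have [a aP] := choice coef.
pose A : 'M[C]_(n.+1, n) := \matrix_(k, i) a k i.
have [v vA v0] : exists2 v : 'rV[C]_n.+1, v *m A = 0 & v != 0.
  have : kermx A != 0.
    by rewrite -mxrank_eq0 mxrank_ker subn_eq0 -ltnNge ltnS rank_leq_col.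
  by move=> /rowV0Pn[v /sub_kermxP vA v0]; exists v.
move/eqP: v0; apply; apply/rowP => k; rewrite mxE.
apply: (@characters_independent _ _ _ (fun k : 'I_n.+1 => chi k) (v 0)).
- by move=> i; apply: chic.
- by move=> i j /chiI ij; apply: val_inj.
move=> h.
have valsum (I : finType) (f : I -> X) : val (\sum_i f i) h = \sum_i val (f i) h.
  by apply: (big_morph (fun x : X => val x h)).
have chiE (i : 'I_n.+1) : chi i h = \sum_(j < n) a i j * val (e j) h.
  have := congr1 (fun x : X => val x h) (aP i); rewrite /= => ->.
  by rewrite valsum.
transitivity (\sum_j (v *m A) 0 j * val (e j) h); last first.
  by rewrite big1// => j _; rewrite vA mxE mul0r.
under eq_bigr do rewrite chiE mulr_sumr.
rewrite exchange_big /=; apply: eq_bigr => j _; rewrite mxE mulr_suml.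
by apply: eq_bigr => i _; rewrite !mxE mulrA.
Qed.

Lemma translation_representation (chi : nat -> G -> C) :
  injective chi -> (forall n, character (chi n)) ->
  (forall n, in_weighted_closure w u (chi n)) -> representation translation.
Proof.
move=> chiI chic chicl; split.
- apply: weighted_span_separable => n h.
  by rewrite char_cmod.
- exact: (span_infinite_dimensional chiI).
- exact: translation_GL.
- exact: translationD.
Qed.

End Translation.

(** * Uncountably many characters in a closure *)

Section PerfectClosure.
Variables (R : realType) (G : zmodType) (w : G -> {posnum R}).
Local Notation C := R[i].

Lemma character_limit (P : nat -> G -> C) (chi : G -> C) :
  (forall n, character (P n)) ->
  (forall h e, 0 < e -> exists N, forall n, (N <= n)%N -> cmod (P n h - chi h) <= e) ->
  character chi.
Proof.
move=> Pc Pchi; split=> [h|h1 h2].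
  apply: unit_cmod; apply/eqP; rewrite eq_le; apply/andP; split.
    apply/ler_addgt0Pr => e /(Pchi h)[N /(_ _ (leqnn _)) NP].
    rewrite -(char_cmod h (Pc N)) -(subrK (P N h) (chi h)) addrC.
    by rewrite (le_trans (cmodD _ _))// lerD// cmodB.
  apply/ler_addgt0Pr => e /(Pchi h)[N /(_ _ (leqnn _)) NP].
  rewrite -(char_cmod h (Pc N)) -{1}(subrK (chi h) (P N h)) addrC.
  by rewrite (le_trans (cmodD _ _))// lerD.
apply/eqP; rewrite -subr_eq0; apply/eqP/cmod_eq0/eqP.
rewrite eq_le cmod_ge0 andbT; apply/ler_addgt0Pr => e e0; rewrite add0r.
have e3 : 0 < e / 3 / (1 + cmod (chi h2)).
  by rewrite !divr_gt0// ltr_pwDl// cmod_ge0.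
have e3' : 0 < e / 3 by rewrite divr_gt0.
have [[N1 P1] [N2 P2]] := (Pchi h1 _ e3, Pchi h2 _ e3').
have [N3 P3] := Pchi (h1 + h2) _ e3'.
pose n := maxn N1 (maxn N2 N3).
have {}P1 : cmod (P n h1 - chi h1) <= e / 3 / (1 + cmod (chi h2)).
  by apply: P1; rewrite leq_maxl.
have {}P2 : cmod (P n h2 - chi h2) <= e / 3.
  by apply: P2; rewrite leq_max leq_maxl orbT.
have {}P3 : cmod (P n (h1 + h2) - chi (h1 + h2)) <= e / 3.
  by apply: P3; rewrite !leq_max leqnn !orbT.
have -> : chi (h1 + h2) - chi h1 * chi h2 =
    - (P n (h1 + h2) - chi (h1 + h2)) +
    (P n h1 * (P n h2 - chi h2) + (P n h1 - chi h1) * chi h2).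
  by rewrite (charD _ _ (Pc n)); ring.
have : cmod ((P n h1 - chi h1) * chi h2) <= e / 3.
  rewrite cmodM; have c0 := cmod_ge0 (chi h2).
  have {}P1 : cmod (P n h1 - chi h1) * (1 + cmod (chi h2)) <= e / 3.
    by rewrite -ler_pdivlMr// ltr_pwDl.
  by apply: le_trans P1; rewrite ler_wpM2l ?cmod_ge0 ?lerDr.
have : cmod (P n h1 * (P n h2 - chi h2)) <= e / 3.
  by rewrite cmodM char_cmod// mul1r.
set a := - (P n _ - _); set b := P n h1 * _; set d := _ * chi h2 => bP dP.
have := cmodD a (b + d); have := cmodD b d.
by move: P3; rewrite -cmodN -/a; lra.
Qed.

(** A sequence of characters that converges to [1] so fast that, at the point
[p n], all the later characters together move less than [th n] does. *)
Definition separating_chain (th : nat -> G -> C) (p : nat -> G) (t : nat -> R) :=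
  forall n, [/\ character (th n), 0 < t n,
    cmod (th n (p n) - 1) = t n * (w (p n))%:num
    & forall h, cmod (th n.+1 h - 1) <= t n / 4 * (w h)%:num].

(** Once [th n] and a point [p n] with [th n (p n) <> 1] are chosen, [t n] is the
weighted distance that they realise, and the next character is taken within
[t n / 4] of [1]. *)
Lemma separating_chain_exists :
  (forall e : R, 0 < e -> exists2 psi : G -> C,
     character psi /\ psi <> trivial_character R G
     & forall h, cmod (psi h - 1) <= e * (w h)%:num) ->
  exists th p t, separating_chain th p t.
Proof.
move=> small.
have step (e : R) : exists q : (G -> C) * G, 0 < e ->
    [/\ character q.1, q.1 q.2 <> 1 & forall h, cmod (q.1 h - 1) <= e * (w h)%:num].
  have [e0|] := ltP 0 e; last by exists ((fun=> 1), 0).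
  have [psi [psic psi1] psie] := small e e0.
  by have [h hpsi] := char_nontrivial psi1; exists (psi, h).
have [nx nxP] := choice step.
pose tt (q : (G -> C) * G) : R := cmod (q.1 q.2 - 1) / (w q.2)%:num.
pose S := fix S n := if n is m.+1 then nx (tt (S m) / 4) else nx 1.
have SP n : character (S n).1 /\ (S n).1 (S n).2 <> 1.
  elim: n => [|n [_ IH]]; first by have [] := nxP 1 ltr01.
  have [|//] := nxP (tt (S n) / 4); rewrite divr_gt0// divr_gt0//.
  by apply: cmod_gt0 => /eqP; rewrite subr_eq0 => /eqP.
have tt0 n : 0 < tt (S n).
  rewrite divr_gt0//; apply: cmod_gt0 => /eqP; rewrite subr_eq0 => /eqP.
  exact: (SP n).2.
exists (fun n => (S n).1), (fun n => (S n).2), (fun n => tt (S n)) => n.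
split=> //; first exact: (SP n).1; first by rewrite /tt divfK.
by have [|//] := nxP (tt (S n) / 4); rewrite divr_gt0.
Qed.

Variables (th : nat -> G -> C) (p : nat -> G) (t : nat -> R).
Hypothesis chain : separating_chain th p t.

Definition chain_prod (s : seq nat) (h : G) : C := \prod_(i <- s) th i h.

Lemma chain_prod_character s : character (chain_prod s).
Proof.
elim: s => [|i s IH].
  have -> : chain_prod [::] = trivial_character R G.
    by apply/funext => h; rewrite /chain_prod big_nil.
  exact: character1.
have -> : chain_prod (i :: s) = (fun h => th i h * chain_prod s h).
  by apply/funext => h; rewrite /chain_prod big_cons.
by apply: characterM => //; have [] := chain i.
Qed.

(** All the finite products of the characters of the chain, enumerated through
the countability of [seq nat]. *)
Definition chain_family (n : nat) : G -> C :=
  chain_prod (odflt [::] (unpickle n)).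

(** The distance realised by [th n.+1] at [p n.+1] cannot exceed the distance
allowed to [th n.+1] by [t n]. *)
Lemma chain_gap_decr n : t n.+1 <= t n / 4.
Proof.
have [_ _ tn _] := chain n.+1; have [_ _ _ /(_ (p n.+1))] := chain n.
by rewrite tn ler_pM2r.
Qed.

Lemma chain_gap_small (e : R) : 0 < e -> exists n, t n <= e.
Proof.
move=> e0; have [_ t0 _ _] := chain 0%N.
have tn n : t n <= t 0 * n.+1%:R^-1.
  elim: n => [|n IH]; first by rewrite invr1 mulr1.
  rewrite (le_trans (chain_gap_decr n))//.
  apply: (@le_trans _ _ (t 0%N * n.+1%:R^-1 / 4)); first by rewrite ler_wpM2r.
  rewrite -mulrA ler_pM2l// -invfM lef_pV2 ?posrE ?mulr_gt0//.
  by rewrite -natrM ler_nat; lia.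
have [|N /(_ _ (leqnn N)) NP] := @inv_succ_small R (e / t 0%N).
  by rewrite divr_gt0.
exists N; rewrite (le_trans (tn N))//.
by rewrite mulrC -ler_pdivlMr.
Qed.

Lemma chain_family_closure chi :
  (forall e, 0 < e -> exists s, forall h,
     cmod (chi h - chain_prod s h) <= e * (w h)%:num) ->
  in_weighted_closure w chain_family chi.
Proof.
move=> chis e /chis[s sP]; exists [:: (1, pickle s)] => h.
by rewrite /lincomb big_seq1 /= mul1r /chain_family pickleK.
Qed.

Lemma chain_in_closure n : in_weighted_closure w chain_family (th n).
Proof.
apply: chain_family_closure => e e0; exists [:: n] => h.
by rewrite /chain_prod big_seq1 subrr cmod0 mulr_ge0// ltW.
Qed.

Lemma chain_later n m : (n < m)%N -> t m <= t n /\
  forall h, cmod (th m h - 1) <= t n / 4 * (w h)%:num.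
Proof.
elim: m => // m IH; rewrite ltnS leq_eqVlt => /predU1P[->|/IH[tmn _]].
  have [_ tm _ thm] := chain m; split=> //.
  rewrite (le_trans (chain_gap_decr m))//; lra.
have [_ tm _ thm] := chain m; split.
  rewrite (le_trans (chain_gap_decr m))//; lra.
move=> h; rewrite (le_trans (thm h))// ler_wpM2r//; lra.
Qed.

(** At [p n] the character [th n] is at distance [t n] from [1], in the units of
the weight, whereas any later one is within [t n / 4]. *)
Lemma chain_injective : injective th.
Proof.
have neq n m : (n < m)%N -> th n <> th m.
  move=> /chain_later[_ /(_ (p n)) thm] thnm; move: thm; rewrite -thnm.
  have [_ tn -> _] := chain n.
  by rewrite ler_pM2r//; lra.
move=> n m thnm; case: (ltngtP n m) => // nm.
- by case: (neq _ _ nm).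
- by case: (neq _ _ nm).
Qed.

(** Build a product step by step, deciding at step [n] whether to include the
factor [th n]. The two options differ by [t n] at [p n], in the units of the
weight, so one of them is at distance at least [t n / 2] from [kappa n] there.
The later steps move the value at [p n] by at most
[t n (1/4 + 1/16 + ...) = t n / 3], so the limit still differs from [kappa n]. *)
Lemma chain_closure_diagonal (kappa : nat -> G -> C) : exists chi : G -> C,
  [/\ character chi, in_weighted_closure w chain_family chi
    & forall n, chi <> kappa n].
Proof.
pose far (s : seq nat) n :=
  t n * (w (p n))%:num / 2 <= cmod (chain_prod s (p n) - kappa n (p n)).
pose s := fix s n := if n is m.+1 then
  if far (s m) m then s m else m :: s m else [::].
pose P n := chain_prod (s n).
have Pc n : character (P n) by exact: chain_prod_character.
have Pfar n : t n * (w (p n))%:num / 2 <= cmod (P n.+1 (p n) - kappa n (p n)).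
  rewrite /P /=; case: ifPn => //; rewrite /far -ltNge => near.
  have [_ tn tnE _] := chain n.
  have cp : chain_prod (n :: s n) (p n) - chain_prod (s n) (p n) =
      chain_prod (s n) (p n) * (th n (p n) - 1).
    by rewrite /chain_prod big_cons; ring.
  have : cmod (chain_prod (n :: s n) (p n) - chain_prod (s n) (p n)) =
      t n * (w (p n))%:num.
    by rewrite cp cmodM (char_cmod _ (Pc n)) mul1r.
  have := cmod_triangle (kappa n (p n)) (chain_prod (n :: s n) (p n))
    (chain_prod (s n) (p n)).
  rewrite (cmodB (kappa _ _)); move: near.
  set a := cmod _; set b := cmod (_ - kappa n (p n)); set d := cmod _ => ? ? ?.
  lra.
have Pstep n h : cmod (P n.+1 h - P n h) <= cmod (th n h - 1).
  rewrite /P /=; case: ifP => _; first by rewrite subrr cmod0 cmod_ge0.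
  have -> : chain_prod (n :: s n) h - chain_prod (s n) h =
      chain_prod (s n) h * (th n h - 1).
    by rewrite /chain_prod big_cons; ring.
  by rewrite cmodM (char_cmod _ (Pc n)) mul1r.
have Ptail d n h : cmod (P (n.+1 + d)%N h - P n.+1 h) <= t n / 3 * (w h)%:num.
  elim: d n => [|d IH] n.
    have [_ tn _ _] := chain n.
    by rewrite addn0 subrr cmod0 mulr_ge0// divr_ge0// ltW.
  rewrite addnS -addSn (le_trans (cmod_triangle (P n.+2 h) _ _))//.
  apply: (@le_trans _ _ (t n.+1 / 3 * (w h)%:num + t n / 4 * (w h)%:num)).
    rewrite lerD// (le_trans (Pstep _ _))//.
    by have [] := chain n.
  rewrite -mulrDl ler_wpM2r//; have := chain_gap_decr n; lra.
have Ple n m h : (n < m)%N -> cmod (P m h - P n.+1 h) <= t n / 3 * (w h)%:num.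
  by move=> nm; rewrite -(subnKC nm) Ptail.
have Plim h : exists l, forall e : R, 0 < e -> exists N, forall n, (N <= n)%N ->
    cmod (P n h - l) <= e.
  apply: cauchy_complex_limit => e e0.
  have [|N NP] := @chain_gap_small (e / (w h)%:num); first by rewrite divr_gt0.
  exists N.+1 => m n Nm Nn.
  rewrite (le_trans (cmod_triangle (P N.+1 h) _ _))// (cmodB (P N.+1 h)).
  have := Ple _ _ h Nm; have := Ple _ _ h Nn.
  have : t N * (w h)%:num <= e by rewrite -ler_pdivlMr.
  lra.
have [chi chiP] := choice Plim.
have chinear n h : cmod (chi h - P n.+1 h) <= t n / 3 * (w h)%:num.
  rewrite cmodB; apply: (cmod_limit_le (chiP h)); exists n.+1 => m nm.
  by rewrite cmodB Ple.
exists chi; split.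
- exact: (character_limit Pc).
- apply: chain_family_closure => e /chain_gap_small[n tn].
  exists (s n.+1) => h; rewrite (le_trans (chinear n h))// ler_wpM2r//.
  by have [_ t0 _ _] := chain n; lra.
- move=> n chin; have := Pfar n; rewrite -chin cmodB.
  have := chinear n (p n); set a := cmod _ => ale.
  have [_ tn _ _] := chain n.
  have : 0 < t n * (w (p n))%:num by rewrite mulr_gt0.
  by move: ale; rewrite mulrAC; lra.
Qed.

End PerfectClosure.

(** * Rapidly convergent characters *)

Section NotJamison.
Variables (R : realType) (G : zmodType) (chi : nat -> G -> R[i]).
Local Notation C := R[i].

Hypothesis chi_char : forall n, character (chi n).
Hypothesis chi_fast : forall h, exists M, forall n, 2 ^+ n * cmod (chi n h - 1) <= M.

(** The length that makes [chi n] tend to [1] at the rate [2 ^- n] relative to it,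
while remaining bounded wherever the characters converge that fast. *)
Definition char_length (h : G) : R := sup [set 2 ^+ n * cmod (chi n h - 1) | n in setT].

Lemma le_char_length n h : 2 ^+ n * cmod (chi n h - 1) <= char_length h.
Proof.
have [M hM] := chi_fast h; apply: ub_le_sup; last by exists n.
by exists M => _ [k _ <-].
Qed.

Lemma char_length_le h M :
  (forall n, 2 ^+ n * cmod (chi n h - 1) <= M) -> char_length h <= M.
Proof.
move=> hM; apply: ge_sup => [|_ [n _ <-]//].
by exists (2 ^+ 0 * cmod (chi 0%N h - 1)); exists 0%N.
Qed.

Lemma char_length_ge0 h : 0 <= char_length h.
Proof. by rewrite (le_trans _ (le_char_length 0 h))// mulr_ge0 ?cmod_ge0. Qed.

Lemma char_lengthD g h : char_length (g + h) <= char_length g + char_length h.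
Proof.
apply: char_length_le => n.
rewrite (le_trans _ (lerD (le_char_length n g) (le_char_length n h)))//.
by rewrite -mulrDr ler_wpM2l ?exprn_ge0// char_sub1D.
Qed.

Lemma char_weight_gt0 h : 0 < 1 + char_length h.
Proof. by rewrite ltr_pwDl// char_length_ge0. Qed.

Definition char_weight (h : G) : {posnum R} := PosNum (char_weight_gt0 h).

(** Subadditivity of the length, in the multiplicative form
[1 + a + b <= (1 + a) (1 + b)]. *)
Lemma char_weight_shift g h :
  (char_weight (h + g))%:num <= (1 + char_length g) * (char_weight h)%:num.
Proof.
rewrite /=; have := char_lengthD h g.
have := char_length_ge0 g; have := char_length_ge0 h; nra.
Qed.

Hypothesis chi_nontrivial : forall n, chi n <> trivial_character R G.

Lemma char_weight_small (e : R) : 0 < e -> exists2 psi : G -> C,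
  character psi /\ psi <> trivial_character R G
  & forall h, cmod (psi h - 1) <= e * (char_weight h)%:num.
Proof.
move=> e0; have [n nP] := exp2_gt e^-1; exists (chi n) => // h.
have n0 : 0 < 2 ^+ n :> R by rewrite exprn_gt0.
rewrite -(ler_pM2l n0) (le_trans (le_char_length n h))// mulrA.
apply: (@le_trans _ _ (1 * (1 + char_length h))); first by rewrite mul1r lerDr.
rewrite ler_wpM2r ?(ltW (char_weight_gt0 h))//.
by rewrite -ler_pdivrMr// div1r.
Qed.

(** The representation by translations on the closed span of a separating chain
is bounded along [g], since the length is. If its spectrum were enumerated by
[kappa], the diagonal argument would produce one more character in it. *)
Lemma fast_characters_not_Jamison (g : nat -> G) (M : R) :
  (forall k n, 2 ^+ n * cmod (chi n (g k) - 1) <= M) -> ~ Jamison_sequence R g.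
Proof.
move=> gM Jg.
have [th [p [t chain]]] := separating_chain_exists char_weight_small.
pose u := chain_family th.
have uc n : character (u n) by exact: (chain_prod_character chain).
have w1 h : 1 <= (char_weight h)%:num by rewrite /= lerDl char_length_ge0.
have c0 h : 0 <= 1 + char_length h by exact/ltW/char_weight_gt0.
pose rho := translation uc c0 char_weight_shift.
have rho_rep : representation rho.
  apply: (translation_representation uc w1 c0 char_weight_shift (chain_injective chain)).
    by move=> n; have [] := chain n.
  exact: chain_in_closure.
have rho_bnd : partially_bounded rho g.
  apply: (@le_lt_trans _ _ (1 + M)%:E); last exact: ltry.
  apply: ge_ereal_sup => _ [k _ <-].
  rewrite (le_trans (translation_opnorm _ _ _ _))// lee_fin lerD2l.
  by apply: char_length_le => n; exact: gM.
have /countable_injP[f finj] := Jg _ rho rho_rep rho_bnd.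
have enum n : exists kappa : G -> C,
    forall psi, unimodular_point_spectrum rho psi -> f psi = n -> psi = kappa.
  have [[kappa [kS kn]]|nok] := pselect (exists psi,
      unimodular_point_spectrum rho psi /\ f psi = n).
    by exists kappa => psi pS pn; apply: finj; rewrite ?inE// kn.
  by exists (fun=> 0) => psi pS pn; case: nok; exists psi.
have [kappa kappaP] := choice enum.
have [psi [psic psicl psik]] := chain_closure_diagonal chain kappa.
apply: (psik (f psi)); apply: kappaP => //.
exact: (character_eigenvector uc w1 c0 char_weight_shift psic).
Qed.

End NotJamison.

(** * The gap criterion *)

Section GapCriterion.
Variable R : realType.
Local Notation C := R[i].

Definition character_gap (G : zmodType) (g : nat -> G) : Prop :=
  exists2 eps : R, 0 < eps &
    forall chi : G -> C, character chi -> chi <> trivial_character R G ->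
      (eps%:E <= ereal_sup (range (fun k => (complex.Re `|chi (g k) - 1|)%:E)))%E.

(** Halving [eps] replaces the supremum by a value that is attained. *)
Lemma character_gapP (G : zmodType) (g : nat -> G) : character_gap g <->
  exists2 eps : R, 0 < eps & forall chi : G -> C, character chi ->
    chi <> trivial_character R G -> exists k, eps <= cmod (chi (g k) - 1).
Proof.
split=> -[eps eps0 gap].
  exists (eps / 2); first by rewrite divr_gt0.
  move=> chi chic chi1; apply: contrapT => nok.
  have := gap chi chic chi1; apply/negP; rewrite -ltNge.
  apply: (@le_lt_trans _ _ (eps / 2)%:E).
    apply: ge_ereal_sup => _ [k _ <-]; rewrite lee_fin leNgt; apply/negP => /ltW ?.
    by apply: nok; exists k.
  by rewrite lte_fin ltr_pdivrMr// ltr_pMr// ltr1n.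
exists eps => // chi chic chi1; have [k gapk] := gap chi chic chi1.
apply: (@le_trans _ _ (cmod (chi (g k) - 1))%:E); first by rewrite lee_fin.
by apply: ereal_sup_ubound; exists k.
Qed.

Lemma finite_ereal_bound (x : \bar R) : (x < +oo)%E -> exists M : R, (x <= M%:E)%E.
Proof.
by case: x => [r _|//|_]; [exists r|exists 0; rewrite leNye].
Qed.

Lemma gap_Jamison (G : zmodType) (g : nat -> G) :
  character_gap g -> Jamison_sequence R g.
Proof.
move=> /character_gapP[eps eps0 gap] X rho rho_rep /finite_ereal_bound[M gM].
apply: (@separating_spectrum_countable _ _ _ rho (range g) M eps) => //.
  move=> _ [k _ <-]; apply: le_trans gM.
  by apply: ereal_sup_ubound; exists k.
by move=> chi chic /(gap _ chic)[k gapk]; exists (g k) => //; exists k.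
Qed.

Lemma subgroup_gen_ind (G : zmodType) (g : nat -> G) (P : set G) :
  P 0 -> (forall x y, P x -> P y -> P (x - y)) -> (forall k, P (g k)) ->
  forall x, x \in subgroup_gen g -> P x.
Proof.
move=> P0 PB Pg x; rewrite /subgroup_gen inE; apply; split.
  split=> [|a b]; rewrite ?inE//; exact: PB.
by move=> _ [k _ <-].
Qed.

Lemma no_gap_small (G : zmodType) (g : nat -> G) : ~ character_gap g ->
  forall e : R, 0 < e -> exists chi : G -> C,
    [/\ character chi, chi <> trivial_character R G
      & forall k, cmod (chi (g k) - 1) <= e].
Proof.
move=> nogap e e0; apply: contrapT => nochi; apply: nogap; apply/character_gapP.
exists e => // chi chic chi1; apply: contrapT => nok; apply: nochi; exists chi.
split=> // k; rewrite leNgt; apply/negP => /ltW ek.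
by apply: nok; exists k.
Qed.

(** Rapid convergence is inherited by sums and opposites, with added bounds. *)
Lemma fast_on_subgroup (G : zmodType) (g : nat -> G) (chi : nat -> G -> C) (M : R) :
  (forall n, character (chi n)) ->
  (forall k n, 2 ^+ n * cmod (chi n (g k) - 1) <= M) ->
  forall h, h \in subgroup_gen g ->
    exists N, forall n, 2 ^+ n * cmod (chi n h - 1) <= N.
Proof.
move=> chic gM; apply: subgroup_gen_ind => [|x y [K xK] [L yL]|k].
- by exists 0 => n; rewrite char0// subrr cmod0 mulr0.
- exists (K + L) => n; rewrite (le_trans _ (lerD (xK n) (yL n)))//.
  rewrite -mulrDr ler_wpM2l ?exprn_ge0// (le_trans (char_sub1D _ _ _))//.
  by rewrite char_sub1N.
- by exists M.
Qed.

(** Characters with [|chi_n (g k) - 1| <= 2 ^- n], which exist when there is no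
gap, converge rapidly on the subgroup generated by [g]. *)
Lemma Jamison_gap (G : zmodType) (g : nat -> G) :
  (forall x : G, x \in subgroup_gen g) -> Jamison_sequence R g -> character_gap g.
Proof.
move=> gen Jg; apply: contrapT => /no_gap_small small.
have [chi chiP] := choice (fun n : nat =>
  small (2 ^- n) (ltac:(by rewrite invr_gt0 exprn_gt0))).
have chic n : character (chi n) by have [] := chiP n.
have fast k n : 2 ^+ n * cmod (chi n (g k) - 1) <= 1.
  have [_ _ /(_ k)] := chiP n.
  by rewrite mulrC -ler_pdivlMr ?exprn_gt0// mul1r.
apply: (fast_characters_not_Jamison chic _ _ fast Jg) => [h|n].
  exact: (fast_on_subgroup chic fast).
by have [] := chiP n.
Qed.

End GapCriterion.

(** * Subgroups of finite index *)

Section FiniteIndex.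
Variables (R : realType) (G : zmodType) (g : nat -> G).
Local Notation C := R[i].

Lemma seq_pigeonhole (T : eqType) (s : seq T) (f : nat -> T) :
  (forall n, f n \in s) -> exists i j, [/\ (i < j)%N, (j <= size s)%N & f i = f j].
Proof.
move=> fs; pose F (i : 'I_(size s).+1) := f i.
have [/injectiveP Finj|/injectivePn[i [j ij fij]]] := boolP (injectiveb F).
  have : (size (codom F) <= size s)%N.
    apply: uniq_leq_size; first by apply/injectiveP.
    by move=> _ /codomP[i ->]; exact: fs.
  by rewrite size_codom card_ord ltnn.
case: (ltngtP i j) => ij'; last by case/eqP: ij; exact: val_inj.
  by exists i, j; split=> //; rewrite -ltnS.
by exists j, i; split=> //; rewrite -ltnS.
Qed.

Lemma subgroup_seq_generates (x : subgroup_type g) :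
  x \in subgroup_gen (subgroup_seq g).
Proof.
case: x => h hg.
have [hg' inh] : exists hg' : h \in subgroup_gen g,
    (exist _ h hg' : subgroup_type g) \in subgroup_gen (subgroup_seq g).
  apply: (@subgroup_gen_ind G g (fun h => exists hg' : h \in subgroup_gen g,
    (exist _ h hg' : subgroup_type g) \in subgroup_gen (subgroup_seq g))) => //.
  - exists (rpred0 _).
    rewrite (_ : exist _ _ _ = 0 :> subgroup_type g) ?rpred0//.
    exact: val_inj.
  - move=> x y [xg xin] [yg yin]; exists (rpredB xg yg).
    rewrite (_ : exist _ _ _ =
        (exist _ x xg : subgroup_type g) - (exist _ y yg : subgroup_type g)).
      exact: rpredB.
    exact: val_inj.
  - by move=> k; exists (mem_subgroup_gen g k); exact: mem_subgroup_gen.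
by rewrite (_ : exist _ _ _ = exist _ h hg' :> subgroup_type g)//; exact: val_inj.
Qed.

Lemma finite_index_transversal : finite_set [set: quotient_type g] ->
  exists s : seq G, forall h, exists2 r, r \in s & h - r \in subgroup_gen g.
Proof.
move=> /(finite_image (fun q : Quotient.quot (subgroup_gen g) => repr q)).
move=> /finite_seqP[s sE]; exists s => h.
pose q : Quotient.quot (subgroup_gen g) := (\pi h)%qT; exists (repr q).
  have : [set repr q | q in [set: Quotient.quot (subgroup_gen g)]] (repr q).
    by exists q.
  by rewrite sE.
by rewrite Quotient.idealrBE reprK.
Qed.

(** By the pigeonhole principle two of the first multiples of [h] agree modulo
the subgroup; the factorial makes the exponent independent of [h]. *)
Lemma finite_index_exponent : finite_set [set: quotient_type g] ->
  exists2 m, (0 < m)%N & forall h, h *+ m \in subgroup_gen g.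
Proof.
move=> /finite_index_transversal[s sP].
exists (size s)`!; first exact: fact_gt0.
move=> h; have [f fP] := choice (fun n : nat =>
  ltac:(have [r rs rh] := sP (h *+ n); exact (ex_intro _ r (conj rs rh)))).
have [i [j [ij js fij]]] := seq_pigeonhole (fun n => (fP n).1).
have hij : h *+ (j - i) \in subgroup_gen g.
  rewrite mulrnBr ?(ltnW ij)//.
  have := rpredB (fP j).2 (fP i).2.
  by rewrite fij opprB addrA subrK.
have /dvdnP[q ->] : (j - i %| (size s)`!)%N.
  by rewrite dvdn_fact// subn_gt0 ij (leq_trans (leq_subr _ _)).
by rewrite mulnC mulrnA rpredMn.
Qed.

(** Some power of [z <> 1], of exponent below [m], is at distance [1/2] from [1],
and that distance is at most [m |z - 1|]. *)
Lemma root_of_unity_gap (z : C) m : (0 < m)%N -> cmod z = 1 -> z ^+ m = 1 ->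
  cmod (z - 1) < (2 * m%:R)^-1 -> z = 1.
Proof.
move=> m0 z1 zm near; apply: contrapT => /(cmod_far_power z1)[j].
rewrite (divn_eq j m) exprD mulnC exprM zm expr1n mul1r.
apply/negP; rewrite -ltNge (le_lt_trans (cmod_exp_sub1 _ z1))//.
apply: (@le_lt_trans _ _ (m%:R * cmod (z - 1))).
  by rewrite ler_wpM2r ?cmod_ge0// ler_nat ltnW// ltn_pmod.
rewrite mulrC -ltr_pdivlMr ?ltr0n//.
by rewrite -invfM.
Qed.

(** With [m G] inside the subgroup, a character [chi] of the subgroup gives the
character [h |-> chi (m h)] of [G], whose convergence to [1] is as rapid. It can
only be trivial when [chi ^ m] is; but then [chi] takes on [g] values that are
[m]-th roots of unity close to [1], hence equal to [1]. *)
Lemma subgroup_Jamison : finite_set [set: quotient_type g] ->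
  Jamison_sequence R g -> Jamison_sequence R (subgroup_seq g).
Proof.
move=> /finite_index_exponent[m m0 mG] Jg; apply: gap_Jamison; apply: contrapT.
move=> /no_gap_small small.
have m2 : 0 < 2 * m%:R :> R by rewrite mulr_gt0// ltr0n.
(* Below [1 / (2 m)], the distance that isolates [1] among the [m]-th roots of
unity. *)
have eps_gt0 n : 0 < 2 ^- n / (2 * (2 * m%:R)) :> R.
  by rewrite divr_gt0// ?invr_gt0 ?exprn_gt0// mulr_gt0.
have [chi chiP] := choice (fun n => small _ (eps_gt0 n)).
pose H h : subgroup_type g := exist _ (h *+ m) (mG h).
have HD x y : H (x + y) = H x + H y.
  by apply: val_inj; rewrite /= mulrnDl.
have Hg k : H (g k) = subgroup_seq g k *+ m.
  by apply: val_inj; rewrite [RHS]raddfMn.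
pose psi n h := chi n (H h).
have chic n : character (chi n) by have [] := chiP n.
have psic n : character (psi n).
  have [[chi1 chiD] _ _] := chiP n; split=> [h|x y]; first exact: chi1.
  by rewrite /psi HD chiD.
have chi_fast k n : 2 ^+ n * (m%:R * cmod (chi n (subgroup_seq g k) - 1)) <= 1.
  have [_ _ /(_ k) near] := chiP n.
  rewrite mulrC -ler_pdivlMr ?exprn_gt0// mul1r -ler_pdivlMl ?ltr0n//.
  rewrite (le_trans near)// mulrC ler_pM2r ?invr_gt0 ?exprn_gt0//.
  have m0' : 0 < m%:R :> R by rewrite ltr0n.
  by rewrite lef_pV2 ?posrE//; [lra|rewrite mulr_gt0].
have chi_fast1 k n : 2 ^+ n * cmod (chi n (subgroup_seq g k) - 1) <= 1.
  rewrite (le_trans _ (chi_fast k n))// ler_wpM2l ?exprn_ge0//.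
  by rewrite ler_peMl ?cmod_ge0// ler1n.
have psi_fast k n : 2 ^+ n * cmod (psi n (g k) - 1) <= 1.
  rewrite (le_trans _ (chi_fast k n))// ler_wpM2l ?exprn_ge0//.
  by rewrite /psi Hg char_sub1Mn.
have psi_bnd h : exists N, forall n, 2 ^+ n * cmod (psi n h - 1) <= N.
  exact: (fast_on_subgroup chic chi_fast1 (subgroup_seq_generates (H h))).
suff psi_nontriv n : psi n <> trivial_character R G.
  exact: (fast_characters_not_Jamison psic psi_bnd psi_nontriv psi_fast Jg).
move=> psi1; have [_ chi1 near] := chiP n; apply: chi1; apply/funext => x.
apply: (subgroup_gen_ind (P := fun y => chi n y = 1) _ _ _
  (subgroup_seq_generates x)) => [|y z cy cz|k].
- by rewrite char0.
- by rewrite charB// cy cz divff ?oner_eq0.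
apply: (@root_of_unity_gap _ m) => //; first exact: char_cmod.
  by rewrite -charMn// -Hg -[LHS]/(psi n (g k)) psi1.
rewrite (le_lt_trans (near k))// ltr_pdivrMr ?mulr_gt0 ?ltr0n//.
rewrite [ltRHS]mulrCA mulVf ?gt_eqF// mulr1.
apply: (@le_lt_trans _ _ 1); last by rewrite ltr1n.
by rewrite invf_le1 ?exprn_gt0// exprn_ege1// ler1n.
Qed.

(** The sequence is completed by coset representatives. They keep the
representation bounded, being finitely many, and a nontrivial character of [G]
that is trivial on the subgroup has, by its values at multiples of some element,
a value far from [1] on one of them. *)
Lemma Jamison_of_subgroup : finite_set [set: quotient_type g] ->
  Jamison_sequence R (subgroup_seq g) -> Jamison_sequence R g.
Proof.
move=> /finite_index_transversal[s sP] /(Jamison_gap subgroup_seq_generates).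
move=> /character_gapP[eps eps0 gap] X rho rho_rep /finite_ereal_bound[M gM].
have [_ _ GLrho _] := rho_rep.
have [N NP] := choice (fun h => finite_ereal_bound (GLrho h).1.2).
pose K : R := `|M| + \sum_(r <- s) `|N r|.
apply: (@separating_spectrum_countable _ _ _ rho (range g `|` [set` s]) K
    (Num.min eps 2^-1)) => //.
- by rewrite lt_min eps0 invr_gt0 ltr0n.
- move=> h [[k _ <-]|/= hs].
    apply: (@le_trans _ _ M%:E); last first.
      rewrite lee_fin (le_trans (ler_norm M))// lerDl.
      by apply: sumr_ge0.
    by apply: le_trans gM; apply: ereal_sup_ubound; exists k.
  rewrite (le_trans (NP h))// lee_fin (le_trans (ler_norm _))// /K.
  rewrite (big_rem h)//= addrCA lerDl addr_ge0//.
  exact: sumr_ge0.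
move=> chi chic chi1; pose res (x : subgroup_type g) := chi (val x).
have [trivial|nontrivial] := pselect (res = trivial_character R (subgroup_type g)).
  have [h hchi] := char_nontrivial chi1.
  have [j jfar] := cmod_far_power (char_cmod h chic) hchi.
  have [r rs hr] := sP (h *+ j); exists r; first by right.
  have chi_hr : chi (h *+ j - r) = 1.
    by have := congr1 (fun f => f (exist _ (h *+ j - r) hr : subgroup_type g)) trivial.
  rewrite ge_min; apply/orP; right.
  suff -> : chi r = chi h ^+ j by [].
  rewrite -charMn// -[h *+ j](subrK r) charD// chi_hr mul1r.
  by [].
have resc : character res.
  have [chi_1 chiD] := chic; split=> [x|x y]; first exact: chi_1.
  exact: chiD.
have [k kgap] := gap res resc nontrivial.
by exists (g k); [left; exists k|rewrite ge_min kgap].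
Qed.

End FiniteIndex.

(** * Extension of characters *)

Section CharacterExtension.
Variables (R : realType) (G : zmodType).
Local Notation C := R[i].
Implicit Types (W : set (G * C)).

(** Characters of subgroups, encoded as their graphs in [G * C]: a subgroup of
[G * C] with unimodular second coordinates that meets the vertical axis
trivially. Unions of chains and extensions by one element are then plain
set constructions. *)
Definition partial_character W :=
  [/\ W (0, 1), forall x y a b, W (x, a) -> W (y, b) -> W (x - y, a / b),
      forall x a, W (x, a) -> cmod a = 1 & forall a, W (0, a) -> a = 1].

(** The subgroup of [G * C] generated by [W] and [(b, z)]. *)
Definition adjoin W (b : G) (z : C) : set (G * C) :=
  [set q | exists x a (k : int), W (x, a) /\ q = (x + b *~ k, a * z ^ k)].

(** For [a <> 1] every [n]-th root of [a] differs from [1]; for [a = 1] a root of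
[1 + X + ... + X^(n-1)] does, because [n <> 0]. *)
Lemma unimodular_root (a : C) n : (1 < n)%N -> cmod a = 1 ->
  exists z, [/\ z ^+ n = a, z <> 1 & cmod z = 1].
Proof.
move=> n1 ca; have n0 : (0 < n)%N by exact: ltn_trans n1.
suff [z [zn z1]] : exists z, z ^+ n = a /\ z <> 1.
  exists z; split=> //; have := congr1 (@cmod R) zn; rewrite cmodX ca.
  by move=> /eqP; rewrite pexpr_eq1 ?cmod_ge0// => /eqP.
have [->|a1] := eqVneq a 1; last first.
  exists (n.-root a); rewrite rootCK//; split=> // r1.
  by move/eqP: a1; apply; rewrite -(rootCK n0 a) r1 expr1n.
have : size (\poly_(i < n) (1 : C)) != 1 by rewrite size_poly_eq ?oner_eq0 ?gtn_eqF.
move=> /closed_rootP[z /rootP]; rewrite horner_poly => sum0.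
have {}sum0 : \sum_(i < n) z ^+ i = 0.
  by rewrite -[RHS]sum0; apply: eq_bigr => i _; rewrite mul1r.
exists z; split; first by apply/eqP; rewrite -subr_eq0 subrX1 sum0 mulr0.
move=> z1; move: sum0; rewrite z1.
under eq_bigr do rewrite expr1n.
by rewrite sumr_const card_ord => /eqP; rewrite pnatr_eq0 gtn_eqF.
Qed.

Section Adjoin.
Variable W : set (G * C).
Hypothesis pW : partial_character W.

Lemma partial_characterN x a : W (x, a) -> W (- x, a^-1).
Proof.
have [W0 WB _ _] := pW => Wxa; have := WB _ _ _ _ W0 Wxa.
by rewrite sub0r div1r.
Qed.

Lemma partial_characterD x y a b : W (x, a) -> W (y, b) -> W (x + y, a * b).
Proof.
have [W0 WB _ _] := pW => Wxa /partial_characterN Wyb.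
by have := WB _ _ _ _ Wxa Wyb; rewrite opprK invrK.
Qed.

Lemma partial_characterMn x a n : W (x, a) -> W (x *+ n, a ^+ n).
Proof.
move=> Wxa; elim: n => [|n IH]; first by rewrite mulr0n expr0; case: pW.
by rewrite mulrS exprS; exact: partial_characterD.
Qed.

Lemma partial_character_fun x a b : W (x, a) -> W (x, b) -> a = b.
Proof.
have [_ WB Wu W1] := pW => Wxa Wxb.
have := WB _ _ _ _ Wxa Wxb; rewrite subrr => /W1 ab.
have b0 : b != 0.
  apply/eqP => b0; have := Wu _ _ Wxb; rewrite b0 cmod0 => /eqP.
  by rewrite eq_sym oner_eq0.
by rewrite -[a](divfK b0) ab mul1r.
Qed.

Lemma adjoin_partial_character b z : cmod z = 1 ->
  (forall (k : nat) a, W (b *+ k, a) -> z ^+ k = a) ->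
  partial_character (adjoin W b z).
Proof.
move=> z1 zW; have [W0 WB Wu W1] := pW.
have z0 : z != 0.
  by apply/eqP => z0; move/eqP: z1; rewrite z0 cmod0 eq_sym oner_eq0.
have zuni : z \is a GRing.unit by rewrite unitfE.
have czk (k : int) : cmod (z ^ k) = 1.
  have nz := unit_cmod z1; apply: cmod_unit.
  by case: k => k; rewrite /exprz ?normfV normrX nz expr1n ?invr1.
have zWz (k : int) a : W (b *~ k, a) -> z ^ k = a.
  case: k => k; first exact: zW.
  rewrite NegzE mulrNz => /partial_characterN; rewrite opprK => /zW zk.
  by rewrite -exprnN zk invrK.
split.
- by exists 0, 1, 0; split=> //; rewrite addr0 mulr1.
- move=> x' y' a' c' [x [a [k [Wxa [-> ->]]]]] [y [c [l [Wyc [-> ->]]]]].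
  exists (x - y), (a / c), (k - l); split; first exact: WB.
  congr pair; first by rewrite mulrzBr opprD addrACA.
  by rewrite expfzDr// invfM mulrACA -invr_expz.
- move=> x' a' [x [a [k [Wxa [_ ->]]]]].
  rewrite cmodM (Wu _ _ Wxa) mul1r.
  exact: czk.
- move=> c [x [a [k [Wxa [/esym/eqP + ->]]]]].
  rewrite addr_eq0 => /eqP xk.
  have /partial_characterN : W (x, a) by [].
  rewrite xk opprK => /zWz ->; rewrite mulfV//.
  apply/eqP => a0; have := Wu _ _ Wxa; rewrite a0 cmod0 => /eqP.
  by rewrite eq_sym oner_eq0.
Qed.

Lemma adjoin_sub b z : W `<=` adjoin W b z.
Proof. by move=> [x a] Wxa; exists x, a, 0; rewrite mulr0z addr0 expr0z mulr1. Qed.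

Lemma adjoin_new b z : adjoin W b z (b, z).
Proof. by case: pW => W0 _ _ _; exists 0, 1, 1; rewrite add0r mul1r. Qed.

(** If no positive multiple of [b] is in the domain, any value at [b] is allowed,
such as [-1]. Otherwise let [n b] be the least one; it has [n > 1], its multiples
are the only multiples of [b] in the domain, and the value at [b] has to be an
[n]-th root of the value at [n b], which can be chosen different from [1]. *)
Lemma adjoin_exists b : (forall a, ~ W (b, a)) ->
  exists z, z <> 1 /\ partial_character (adjoin W b z).
Proof.
move=> bW; have [W0 WB Wu W1] := pW.
pose dom n := `[< (0 < n)%N /\ exists a, W (b *+ n, a) >].
have [exn|noex] := pselect (exists n, dom n); last first.
  exists (-1); split.
    move=> /eqP; rewrite eq_sym -subr_eq0 opprK -(natrD _ 1 1).
    by rewrite pnatr_eq0.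
  apply: adjoin_partial_character => [|k a]; first by rewrite cmodN cmod1.
  case: k => [|k] Wk; first by rewrite expr0 (W1 a).
  by case: noex; exists k.+1; apply/asboolP; split=> //; exists a.
have nP := ex_minnP exn; case: nP => n /asboolP[n0 [a Wna]] nmin.
have n1 : (1 < n)%N.
  rewrite ltn_neqAle n0 andbT; apply/eqP => n1.
  by apply: (bW a); rewrite -n1 in Wna.
have [z [zn z1 cz]] := unimodular_root n1 (Wu _ _ Wna).
exists z; split=> //; apply: adjoin_partial_character => // k c Wkc.
have Wq := partial_characterMn (k %/ n) Wna.
have kE : b *+ k = (b *+ n) *+ (k %/ n) + b *+ (k %% n).
  by rewrite -mulrnA -mulrnDr mulnC -divn_eq.
have Wr : W (b *+ (k %% n), c / a ^+ (k %/ n)).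
  have -> : b *+ (k %% n) = b *+ k - (b *+ n) *+ (k %/ n).
    by rewrite kE addrC addKr.
  exact: WB.
have r0 : (k %% n)%N = 0%N.
  apply/eqP; rewrite -leqn0 leqNgt; apply/negP => r0.
  have : (n <= k %% n)%N.
    by apply: nmin; apply/asboolP; split=> //; eexists; exact: Wr.
  by rewrite leqNgt ltn_pmod.
have := W1 (c / a ^+ (k %/ n)); rewrite r0 in Wr => /(_ Wr) /divr1_eq ->.
by rewrite {1}(divn_eq k n) r0 addn0 mulnC exprM zn.
Qed.

End Adjoin.

(** Zorn's lemma gives a maximal graph, and a maximal graph is total by
[adjoin_exists]. *)
Lemma partial_character_extend W : partial_character W ->
  exists2 chi : G -> C, character chi & forall x a, W (x, a) -> chi x = a.
Proof.
(* The union with [W] makes the empty chain harmless: its union still has to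
satisfy [P]. *)
move=> pW; pose P A := partial_character (W `|` A).
have [|A [PA Amax]] := @Zorn_bigcup _ P.
  move=> F FP Ftot.
  have mem q : (W `|` \bigcup_(X in F) X) q ->
      W q \/ exists2 X, F X & (W `|` X) q.
    by move=> [|[X FX Xq]]; [left|right; exists X => //; right].
  have inU X q : F X -> (W `|` X) q -> (W `|` \bigcup_(X in F) X) q.
    by move=> FX [|Xq]; [left|right; exists X].
  have mem2 q r : (W `|` \bigcup_(X in F) X) q -> (W `|` \bigcup_(X in F) X) r ->
      (W q /\ W r) \/ exists2 X, F X & (W `|` X) q /\ (W `|` X) r.
    move=> /mem[Wq|[X FX Xq]] /mem[Wr|[Y FY Yr]].
    - by left.
    - by right; exists Y => //; split=> //; left.
    - by right; exists X => //; split=> //; left.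
    - have [XY|YX] := Ftot _ _ FX FY.
        by right; exists Y => //; split=> //; case: Xq => [|/XY]; [left|right].
      by right; exists X => //; split=> //; case: Yr => [|/YX]; [left|right].
  have [W0 WB Wu W1] := pW; split.
  - by left.
  - move=> x y a b qx qy; have [[Wx Wy]|[X FX [Xx Xy]]] := mem2 _ _ qx qy.
      by left; exact: WB.
    have [_ XB _ _] := FP _ FX.
    by apply: (inU X) => //; exact: XB.
  - move=> x a /mem[|[X FX]]; first exact: Wu.
    by have [_ _ Xu _] := FP _ FX; exact: Xu.
  - move=> a /mem[|[X FX]]; first exact: W1.
    by have [_ _ _ X1] := FP _ FX; exact: X1.
have total x : exists a, (W `|` A) (x, a).
  apply: contrapT => nox.
  have [|z [_ pz]] := adjoin_exists PA (b := x).
    by move=> a ?; apply: nox; exists a.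
  apply: (Amax (adjoin (W `|` A) x z)).
    split; first by move=> q Aq; apply: adjoin_sub; right.
    move=> /(_ _ (adjoin_new PA x z)) Axz; apply: nox; exists z; by right.
  rewrite /P (_ : W `|` _ = adjoin (W `|` A) x z)//.
  apply/seteqP; split=> [q [Wq|//]|q]; last by right.
  by apply: adjoin_sub; left.
have [chi chiP] := choice total; exists chi.
  have [_ _ Au _] := PA; split=> [h|x y]; first exact/unit_cmod/(Au h).
  by apply: (partial_character_fun PA (chiP _)); exact: partial_characterD.
by move=> x a Wxa; apply: (partial_character_fun PA (chiP _)); left.
Qed.

(** Starting from the trivial character of [H], the value at [b] can be chosen
different from [1], and the result extended to [G]. *)
Lemma character_separation (H : set G) (b : G) :
  H 0 -> (forall x y, H x -> H y -> H (x - y)) -> ~ H b ->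
  exists chi : G -> C, [/\ character chi, forall x, H x -> chi x = 1 & chi b <> 1].
Proof.
move=> H0 HB Hb; pose W : set (G * C) := [set q | H q.1 /\ q.2 = 1].
have pW : partial_character W.
  split=> [|x y a c [/= Hx ->] [/= Hy ->]|x a [_ /= ->]|a [_ /= ->]//].
  - by [].
  - by split; [exact: HB|rewrite /= divr1].
  - by rewrite cmod1.
have [|z [z1 /partial_character_extend[chi chic chiW]]] := adjoin_exists pW (b := b).
  by move=> a [/= /Hb].
exists chi; split=> // [x Hx|].
  by apply: chiW; apply: adjoin_sub.
by rewrite (chiW b z)//; exact: adjoin_new.
Qed.

End CharacterExtension.

(** * Subgroups of infinite index *)

Section Dirichlet.
Variable R : realType.
Local Notation C := R[i].

(** Dirichlet's pigeonhole argument: cut the square that contains the unit circle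
into cells of side at most [eta / 2]; two of the powers of [z] share a cell, and
their quotient is the required power. The bound [L] counts the cells, and hence
does not depend on [z]. *)
Lemma unimodular_return (eta : R) : 0 < eta -> exists L, forall z : C, cmod z = 1 ->
  exists m, [/\ (0 < m)%N, (m <= L)%N & cmod (z ^+ m - 1) <= eta].
Proof.
move=> eta0.
have [B [B0 etaB]] : exists B : nat, 0 < B%:R :> R /\ 2 <= eta * B%:R.
  exists (Num.truncn (2 / eta)).+1; split; first by rewrite ltr0n.
  by rewrite mulrC -ler_pdivrMr// ltW// truncnS_gt.
pose cell (x : R) := Num.truncn ((x + 1) * B%:R).
have cell_bound (x : R) : `|x| <= 1 -> cell x \in iota 0 (2 * B).+1.
  rewrite ler_norml => /andP[x1 x2]; rewrite mem_iota add0n /= ltnS.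
  have /truncn_itv/andP[cx _] : 0 <= (x + 1) * B%:R.
    by rewrite mulr_ge0 ?ler0n//; lra.
  by rewrite -(ler_nat R) (le_trans cx)// natrM ler_pM2r//; lra.
have cell_eq (x y : R) : `|x| <= 1 -> `|y| <= 1 -> cell x = cell y ->
    `|x - y| <= eta / 2.
  rewrite !ler_norml => /andP[x1 x2] /andP[y1 y2] xy.
  have /truncn_itv/andP[a1 a2] : 0 <= (x + 1) * B%:R.
    by rewrite mulr_ge0 ?ler0n//; lra.
  have /truncn_itv/andP[b1 b2] : 0 <= (y + 1) * B%:R.
    by rewrite mulr_ge0 ?ler0n//; lra.
  move: a1 a2 b1 b2; rewrite -/(cell x) -/(cell y) xy -[(cell y).+1%:R]natr1.
  move: B0 etaB; set k := (cell y)%:R; set b := B%:R => b0 etab a1 a2 b1 b2.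
  by apply/andP; split; rewrite -(ler_pM2r b0); lra.
pose s := [seq (i, j) | i <- iota 0 (2 * B).+1, j <- iota 0 (2 * B).+1].
exists (size s) => z z1.
pose f n := (cell (complex.Re (z ^+ n)), cell (complex.Im (z ^+ n))).
have zn1 n : cmod (z ^+ n) = 1 by rewrite cmodX z1 expr1n.
have Re1 n : `|complex.Re (z ^+ n)| <= 1 by rewrite -(zn1 n) cmod_Re.
have Im1 n : `|complex.Im (z ^+ n)| <= 1 by rewrite -(zn1 n) cmod_Im.
have [|i [j [ij js [fRe fIm]]]] := @seq_pigeonhole _ s f.
  by move=> n; apply: allpairs_f; exact: cell_bound.
exists (j - i)%N; split; first by rewrite subn_gt0.
  by rewrite (leq_trans (leq_subr _ _)).
have -> : cmod (z ^+ (j - i) - 1) = cmod (z ^+ j - z ^+ i).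
  rewrite -[LHS]mul1r -(zn1 i) -cmodM mulrBr mulr1 -exprD subnKC//.
  exact: ltnW.
rewrite (le_trans (cmod_le_ReIm _))//.
rewrite complex_ReB complex_ImB (splitr eta) lerD//.
  exact/cell_eq.
exact/cell_eq.
Qed.

(** By induction: a power that brings the first [M] numbers close to [1] is raised
to a further power, of bounded exponent, that takes care of the last one. *)
Lemma simultaneous_return M (eta : R) : 0 < eta -> exists L, forall z : nat -> C,
  (forall i, cmod (z i) = 1) -> exists m, [/\ (0 < m)%N, (m <= L)%N &
    forall i, (i < M)%N -> cmod (z i ^+ m - 1) <= eta].
Proof.
elim: M eta => [|M IH] eta eta0.
  by exists 1%N => z _; exists 1%N.
have [L2 L2P] := unimodular_return eta0.
have [|L1 L1P] := IH (eta / L2.+1%:R); first by rewrite divr_gt0.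
exists (L1 * L2)%N => z z1.
have [m1 [m1_gt0 m1L m1P]] := L1P z z1.
have zM1 : cmod (z M ^+ m1) = 1 by rewrite cmodX z1 expr1n.
have [m2 [m2_gt0 m2L m2P]] := L2P _ zM1.
exists (m1 * m2)%N; split; rewrite ?muln_gt0 ?m1_gt0 ?leq_mul// => i.
rewrite ltnS leq_eqVlt => /predU1P[->|iM]; first by rewrite exprM.
rewrite exprM (le_trans (cmod_exp_sub1 _ _))//; first by rewrite cmodX z1 expr1n.
apply: (@le_trans _ _ (m2%:R * (eta / L2.+1%:R))).
  by rewrite ler_wpM2l// m1P.
rewrite mulrCA ler_piMr ?(ltW eta0)//.
by rewrite ler_pdivrMr// mul1r ler_nat ltnW.
Qed.

End Dirichlet.

Section InfiniteIndex.
Variables (R : realType) (G : zmodType) (g a : nat -> G).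
Local Notation C := R[i].

(** A group with finitely many generators of bounded exponent is the image of
finitely many exponent vectors. *)
Lemma finite_quotient M N : (0 < N)%N ->
  (forall h, exists k : 'I_M -> nat, h - \sum_(i < M) a i *+ k i \in subgroup_gen g) ->
  (forall h, h *+ N \in subgroup_gen g) ->
  finite_set [set: quotient_type g].
Proof.
case: N => // N _ gen expN.
pose proj (h : G) : Quotient.quot (subgroup_gen g) := (\pi h)%qT.
pose F (f : {ffun 'I_M -> 'I_N.+1}) := proj (\sum_(i < M) a i *+ f i).
apply: (@sub_finite_set _ _ (range F)); last exact/finite_image/finite_finset.
move=> q _; have [k kP] := gen (repr q).
exists [ffun i => Ordinal (ltn_pmod (k i) (ltn0Sn N))] => //.
rewrite -[RHS]reprK; apply/eqP; rewrite eq_sym -Quotient.idealrBE.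
rewrite (_ : _ - _ = (repr q - \sum_(i < M) a i *+ k i) +
    \sum_(i < M) (a i *+ (k i %/ N.+1)) *+ N.+1).
  by apply: rpredD => //; apply: rpred_sum.
rewrite -addrA; congr (_ + _); rewrite -sumrN -sumrN -big_split /=.
apply: eq_bigr => i _; rewrite ffunE /= -mulrnA {2}(divn_eq (k i) N.+1).
by rewrite mulrnDr opprD addrAC addNr add0r.
Qed.

Hypothesis infinite_index : infinite_set [set: quotient_type g].

(** If [1] were isolated, at scale [eta] on the [M] first [a i], then a bounded
power of every character that is trivial on the subgroup would be [1], so the
quotient would have finite exponent, as characters separate its points. For the
same reason the [a i] would generate the quotient: a character that is trivial on
them is [1] by isolation. The quotient would be finite. *)
Lemma annihilator_not_isolated M (eta : R) : 0 < eta -> exists chi : G -> C,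
  [/\ character chi, chi <> trivial_character R G,
      forall h, h \in subgroup_gen g -> chi h = 1
    & forall i, (i < M)%N -> cmod (chi (a i) - 1) <= eta].
Proof.
move=> eta0; apply: contrapT => isolated.
have isol (chi : G -> C) : character chi ->
    (forall h, h \in subgroup_gen g -> chi h = 1) ->
    (forall i, (i < M)%N -> cmod (chi (a i) - 1) <= eta) -> forall h, chi h = 1.
  move=> chic chig chia; apply: contrapT => chi1; apply: isolated; exists chi.
  by split=> // chiE; apply: chi1 => h; rewrite chiE.
have [L LP] := simultaneous_return M eta0.
have expL (chi : G -> C) h : character chi ->
    (forall h, h \in subgroup_gen g -> chi h = 1) ->
    chi h ^+ L`! = 1.
  move=> chic chig; have [|m [m0 mL mP]] := LP (fun i => chi (a i)).
    by move=> i; exact: char_cmod.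
  have chim : chi h ^+ m = 1.
    apply: (isol _ (characterX m chic)) => // x /chig ->.
    exact: expr1n.
  have /dvdnP[q ->] : (m %| L`!)%N by rewrite dvdn_fact// m0 mL.
  by rewrite mulnC exprM chim expr1n.
have G0 : 0 \in subgroup_gen g by exact: rpred0.
have GB x y : x \in subgroup_gen g -> y \in subgroup_gen g ->
  x - y \in subgroup_gen g by exact: rpredB.
have expG h : h *+ L`! \in subgroup_gen g.
  apply: contrapT => hL.
  have [chi [chic chig]] :=
    @character_separation R G [set x | x \in subgroup_gen g] _ G0 GB hL.
  by rewrite charMn// expL.
pose S : set G := [set h |
  exists k : 'I_M -> nat, h - \sum_(i < M) a i *+ k i \in subgroup_gen g].
have GS h : h \in subgroup_gen g -> S h.
  by move=> hg; exists (fun=> 0%N); rewrite big1 ?subr0.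
have SB x y : S x -> S y -> S (x - y).
  move=> [k kx] [l ly]; exists (fun i => (k i + (L`!).-1 * l i)%N).
  rewrite (_ : _ - _ = (x - \sum_(i < M) a i *+ k i) - (y - \sum_(i < M) a i *+ l i) -
      \sum_(i < M) (a i *+ l i) *+ L`!).
    by apply: rpredB; [exact: rpredB|apply: rpred_sum].
  have -> : \sum_(i < M) a i *+ (k i + (L`!).-1 * l i) =
      \sum_(i < M) a i *+ k i - \sum_(i < M) a i *+ l i +
      \sum_(i < M) (a i *+ l i) *+ L`!.
    rewrite -sumrN -!big_split /=; apply: eq_bigr => i _.
    rewrite mulrnDr -addrA; congr (_ + _).
    by rewrite -mulrnA mulnC -{2}(prednK (fact_gt0 L)) mulnS mulrnDr addKr.
  by rewrite !opprD !opprK !addrA; rewrite (addrAC x).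
have Sa i : (i < M)%N -> S (a i).
  move=> iM; exists (fun j => (j == Ordinal iM)).
  rewrite (bigD1 (Ordinal iM))//= eqxx mulr1n big1 ?addr0 ?subrr//.
  by move=> j /negPf ->.
have SG h : S h.
  apply: contrapT => Sh.
  have [chi [chic chiS]] := @character_separation R G S _ (GS _ G0) SB Sh.
  apply; apply: isol => // [x /GS/chiS//|i /Sa/chiS ->].
  by rewrite subrr cmod0 ltW.
by apply: infinite_index; apply: (finite_quotient (fact_gt0 L) SG expG).
Qed.

(** A character within [2 ^- n] of [1] on the [n + 1] first elements of the
enumeration [a], for each [n], makes up a sequence that converges rapidly at every
element of [G], and it is constant on the sequence [g]. *)
Lemma infinite_index_not_Jamison : (forall h, exists i, a i = h) ->
  ~ Jamison_sequence R g.
Proof.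
move=> asurj.
have eps0 n : 0 < 2 ^- n :> R by rewrite invr_gt0 exprn_gt0.
have [chi chiP] := choice (fun n => annihilator_not_isolated n.+1 (eps0 n)).
have chic n : character (chi n) by have [] := chiP n.
have chi1 n : chi n <> trivial_character R G by have [] := chiP n.
have chi_fast h : exists M, forall n, 2 ^+ n * cmod (chi n h - 1) <= M.
  have [i <-] := asurj h; exists (Num.max 1 (2 ^+ i * 2)) => n.
  rewrite le_max; case: (ltnP n i) => ni; apply/orP; [right|left].
    apply: ler_pM; rewrite ?exprn_ge0 ?cmod_ge0//.
      by rewrite ler_eXn2l ?ltr1n// ltnW.
    rewrite (le_trans (cmodD _ _))// cmodN cmod1 char_cmod//.
  have [_ _ _ /(_ i)] := chiP n; rewrite ltnS => /(_ ni) near.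
  by rewrite mulrC -ler_pdivlMr ?exprn_gt0// mul1r.
apply: (fast_characters_not_Jamison chic chi_fast chi1 (M := 0)) => k n.
have [_ _ chig _] := chiP n.
by rewrite chig ?mem_subgroup_gen// subrr cmod0 mulr0.
Qed.

End InfiniteIndex.

Lemma countable_surjection (T : pointedType) : countable [set: T] ->
  exists a : nat -> T, forall x, exists n, a n = x.
Proof.
move=> /countable_injP[f finj].
have pre n : exists x : T, forall y, f y = n -> y = x.
  have [[x fx]|nox] := pselect (exists x, f x = n).
    by exists x => y fy; apply: finj; rewrite ?inE// fx.
  by exists point => y fy; case: nox; exists y.
have [a aP] := choice pre; exists a => x; exists (f x).
exact/esym/aP.
Qed.

Theorem theorem1p13 (R : realType) (G : zmodType)
  (G_countably_infinite : ([set: G] #= [set: nat])%card) (g : nat -> G) :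
  (infinite_set [set: quotient_type g] -> ~ Jamison_sequence R g) /\
  (finite_set [set: quotient_type g] ->
     (Jamison_sequence R g <-> Jamison_sequence R (subgroup_seq g)) /\
     ((forall x : G, x \in subgroup_gen g) ->
        (Jamison_sequence R g <->
         exists2 eps : R, 0 < eps &
           forall chi : G -> R[i],
             character chi -> chi <> trivial_character R G ->
             (eps%:E <= ereal_sup
                (range (fun k => (complex.Re `|chi (g k) - 1|)%:E)))%E))).
Proof.
split=> [infG|finG].
  have [|a asurj] := @countable_surjection G.
    by have /card_eqPle[] := G_countably_infinite.
  exact: (infinite_index_not_Jamison infG asurj).
split.
  by split; [exact: subgroup_Jamison|exact: Jamison_of_subgroup].
by move=> gen; split; [exact: Jamison_gap|exact: gap_Jamison].
Qed.
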